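(* Let $k\ge1$, $s_1,\dots,s_k>0$ and $B_1,\dots,B_k$ be $2\times2$ matrices with $\|B_i\|_2=1$. (a) Real case: if $B_i\in M_2(\mathbb R)$ and $\mathcal M_{\mathbb R}(\exp(s_kB_k)\cdots\exp(s_1B_1))=s_1+\dots+s_k$, then either (i) there are an orthogonal matrix $U$, a sign $\varepsilon\in\{1,-1\}$ and reals $\lambda_1,\dots,\lambda_k$ such that $UB_iU^{-1}=\operatorname{diag}(\varepsilon,\lambda_i)$ for all $i$; or (ii) there is an orthogonal matrix $U_0$ with $B_1=\dots=B_k=U_0$. (b) Complex case: if $B_i\in M_2(\mathbb C)$ and $\mathcal M_{\mathbb C}(\exp(s_kB_k)\cdots\exp(s_1B_1))=s_1+\dots+s_k$, then there are a unitary $V$, a complex number $u$ with $|u|=1$ and complex numbers $\lambda_1,\dots,\lambda_k$ such that $VB_iV^{-1}=\operatorname{diag}(u,\lambda_i)$ for all $i$.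
   Context: $\|\cdot\|_2$ is the operator norm. $\mathcal M_{\mathbb F}(A)=\inf\{\sum_{i=1}^m\|C_i\|_2: m\ge1,\ C_i\in M_2(\mathbb F),\ \exp(C_m)\cdots\exp(C_1)=A\}$ is the Magnus exponent. *)

(* Defs.v *)
From HB Require Import structures.
From mathcomp Require Import all_boot all_order all_algebra.
From mathcomp Require Import all_classical all_reals all_analysis.
From mathcomp Require Import complex.
Import Order.TTheory GRing.Theory Num.Theory.
Import numFieldNormedType.Exports.

Set Implicit Arguments.
Unset Strict Implicit.
Unset Printing Implicit Defensive.

Local Open Scope ring_scope.
Local Open Scope classical_set_scope.

Definition expm (K : numFieldType) (A : 'M[K]_2) : 'M[K]_2 :=
  limn (series (fun n => (n`!%:R)^-1 *: A ^+ n)).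

Definition opnorm (R : realType) (K : numFieldType) (absv : K -> R)
    (A : 'M[K]_2) : R :=
  sup [set Num.sqrt (\sum_(i < 2) absv ((A *m x) i ord0) ^+ 2) |
        x in [set x : 'cV[K]_2 | \sum_(i < 2) absv (x i ord0) ^+ 2 = 1]].

(* Magnus exponent: inf { sum ||C_i||_2 : m >= 1, exp(C_m)...exp(C_1) = A }.
   With C indexed by 'I_m (C_1 = C ord0), the product
   \prod_(i < m) expm (C (rev_ord i)) is exp(C_{m-1}) ... exp(C_0). *)
Definition magnus (R : realType) (K : numFieldType) (absv : K -> R)
    (A : 'M[K]_2) : R :=
  inf [set r : R | exists (m : nat) (C : 'I_m -> 'M[K]_2),
        [/\ (0 < m)%N,
            \prod_(i < m) expm (C (rev_ord i)) = A &
            r = \sum_(i < m) opnorm absv (C i)]].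

Definition opnormR (R : realType) (A : 'M[R]_2) : R := opnorm (fun x : R => `|x|) A.
Definition magnusR (R : realType) (A : 'M[R]_2) : R := magnus (fun x : R => `|x|) A.

Definition cabs (R : realType) (z : R[i]) : R := complex.Re `|z|.
Definition opnormC (R : realType) (A : 'M[R[i]]_2) : R := opnorm (@cabs R) A.
Definition magnusC (R : realType) (A : 'M[R[i]]_2) : R := magnus (@cabs R) A.

Definition orthogonal_mx (R : realType) (U : 'M[R]_2) : Prop :=
  U^T *m U = 1%:M.

Definition unitary_mx (R : realType) (V : 'M[R[i]]_2) : Prop :=
  (map_mx (@Num.conj _) V)^T *m V = 1%:M.

Definition diag2 (K : numFieldType) (a b : K) : 'M[K]_2 :=
  diag_mx (\row_(j < 2) (if j == ord0 then a else b)).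

(* exp(s_k B_k) ... exp(s_1 B_1), with s_1 = s ord0, B_1 = B ord0 *)
Definition prod_exp (K : numFieldType) (k : nat) (s : 'I_k -> K)
    (B : 'I_k -> 'M[K]_2) : 'M[K]_2 :=
  \prod_(i < k) expm (s (rev_ord i) *: B (rev_ord i)).

(* Main.v *)
(* A word of matrices is minimal when no word with the same product of
   exponentials has smaller total norm; equality in the hypothesis says that the
   given word is minimal, and subwords and subdivisions of a minimal word are
   minimal. First-order variation: change the velocity near one time by D1, near
   another time by D2, and compensate at the junction by the conjugated change D.
   On slots of length e^2 with relative changes e the product is preserved up to
   O(e^4), and this error is repaired at cost O(e^4), so the sum of the
   directional derivatives of the norm, which enters at order e^3, is nonnegative.

   For two consecutive letters A, B this gives ||A + B|| = 2, hence a unit vector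
   x with A x = B x = y, |y| = 1. If B is not unitary then x is, up to a scalar,
   the only maximizing vector, the norm is differentiable at B, and
   stationarity for all D1 forces x to be an eigenvector. If A and B are unitary,
   stationarity for D1 = A S with S antihermitian forces x to be an eigenvector
   of A + A^* and of B + B^*, with the same eigenvalue <x,y> + <y,x>; then A and
   B also agree on y, so that A = B or y is a multiple of x. In all cases A and
   B commute. Two consecutive letters can thus be merged into one, and the
   structure of a minimal word follows by induction, using strict convexity
   of the Euclidean ball to undo the merging. *)
Require Import Defs.
From HB Require Import structures.
From mathcomp Require Import all_boot all_order all_algebra.
From mathcomp Require Import all_classical all_reals all_analysis.
From mathcomp Require Import complex.
From mathcomp Require Import ring lra.
Import Order.TTheory GRing.Theory Num.Theory.
Import numFieldNormedType.Exports.
Set Implicit Arguments.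
Unset Strict Implicit.
Unset Printing Implicit Defensive.
Local Open Scope ring_scope.
Local Open Scope classical_set_scope.

(** * The Hermitian plane and the operator norm *)

(* Common structure of R and R[i]: [emb], [cj], [rp], [av] are the embedding of R,
   the conjugation, the real part and the absolute value. In [log_near1] the logarithm is a sum of two terms so
   that, for R[i], modulus and phase can be handled separately. *)
Record hermitian_field (R : realType) (K : numFieldType) := HermitianField {
  emb : {rmorphism R -> K};
  cj : {rmorphism K -> K};
  rp : K -> R;
  av : K -> R;
  cjK : involutive cj;
  cj_emb : forall a, cj (emb a) = emb a;
  rpD : {morph rp : y z / y + z};
  rp_emb : forall a z, rp (emb a * z) = a * rp z;
  rp_cj : forall z, rp (cj z) = rp z;
  rp1 : rp 1 = 1;
  av_cj : forall z, emb (av z ^+ 2) = cj z * z;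
  av_norm : forall z, emb (av z) = `|z|;
  emb_le : {mono emb : a b / a <= b};
  av_complete : forall u : nat -> K,
    (exists M, forall n, \sum_(k < n) av (u k) <= M) ->
    exists l : K, series u @ \oo --> l;
  log_near1 : exists2 c : R, 0 < c & forall y : K, av y <= 4^-1 ->
    exists z1 z2 e1 e2 : K, [/\ series (fun n => n`!%:R^-1 * z1 ^+ n) @ \oo --> e1,
      series (fun n => n`!%:R^-1 * z2 ^+ n) @ \oo --> e2,
      e1 * e2 = 1 + y & av z1 + av z2 <= c * av y]
}.

Section Hermitian.
Variables (R : realType) (K : numFieldType) (H : hermitian_field R K).
Local Notation emb := (emb H).
Local Notation cj := (cj H).
Local Notation rp := (rp H).
Local Notation av := (av H).
Implicit Types (a b c : R) (z w : K) (u v x y : 'cV[K]_2) (A B : 'M[K]_2).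

Lemma emb_inj : injective emb.
Proof. exact: fmorph_inj. Qed.

Lemma rpB : {morph rp : z w / z - w}.
Proof.
have r0 : rp 0 = 0 by have := rp_emb H 0 0; rewrite rmorph0 !mul0r.
have rN z : rp (- z) = - rp z.
  by apply/eqP; rewrite -subr_eq0 opprK -rpD addNr r0.
by move=> z w; rewrite rpD rN.
Qed.

Lemma rp0 : rp 0 = 0.
Proof. by rewrite -[X in rp X](subrr 0) rpB subrr. Qed.

Lemma rpN z : rp (- z) = - rp z.
Proof. by rewrite -sub0r rpB rp0 sub0r. Qed.

Lemma rp_real a : rp (emb a) = a.
Proof. by rewrite -[emb a]mulr1 rp_emb rp1 mulr1. Qed.

Lemma av_ge0 z : 0 <= av z.
Proof. by rewrite -(emb_le H) av_norm rmorph0. Qed.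

Lemma av_sqr z : av z ^+ 2 = rp (cj z * z).
Proof. by rewrite -av_cj rp_real. Qed.

Lemma av0_eq0 z : av z = 0 -> z = 0.
Proof. by move=> z0; apply/normr0_eq0; rewrite -(av_norm H) z0 rmorph0. Qed.

Lemma av0 : av 0 = 0.
Proof. by apply: emb_inj; rewrite av_norm normr0 rmorph0. Qed.

Lemma av1 : av 1 = 1.
Proof. by apply: emb_inj; rewrite av_norm normr1 rmorph1. Qed.

Lemma avM z w : av (z * w) = av z * av w.
Proof. by apply: emb_inj; rewrite rmorphM !av_norm normrM. Qed.

Lemma avV z : av z^-1 = (av z)^-1.
Proof. by apply: emb_inj; rewrite fmorphV !av_norm normfV. Qed.

Lemma avD z w : av (z + w) <= av z + av w.
Proof. by rewrite -(emb_le H) rmorphD !av_norm ler_normD. Qed.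

Lemma avN z : av (- z) = av z.
Proof. by apply: emb_inj; rewrite !av_norm normrN. Qed.

Lemma av_emb a : av (emb a) = `|a|.
Proof.
apply/eqP; rewrite -(@eqrXn2 _ 2) ?av_ge0 // av_sqr cj_emb -rmorphM rp_real.
by rewrite real_normK ?num_real.
Qed.

Lemma av_natV n : av (n%:R^-1) = n%:R^-1.
Proof. by rewrite -(rmorph_nat emb) -fmorphV av_emb ger0_norm. Qed.

Lemma avcj z : av (cj z) = av z.
Proof.
apply/eqP; rewrite -(@eqrXn2 _ 2) ?av_ge0 //; apply/eqP.
by apply: emb_inj; rewrite !av_cj cjK mulrC.
Qed.

Lemma rp_le_av z : rp z <= av z.
Proof.
rewrite real_ler_normlW ?num_real// -(@ler_pXn2r _ 2) ?nnegrE ?av_ge0 ?normr_ge0//.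
rewrite real_normK ?num_real//.
(* Expanding the square of [av (z - emb (rp z))] gives [rp z ^+ 2 <= av z ^+ 2]. *)
have := sqr_ge0 (av (z - emb (rp z))); rewrite av_sqr rmorphB cj_emb.
have -> : (cj z - emb (rp z)) * (z - emb (rp z)) = cj z * z - emb (rp z) * z
    - emb (rp z) * cj z + emb (rp z) * emb (rp z) by ring.
rewrite rpD !rpB !rp_emb rp_real rp_cj -av_sqr.
nra.
Qed.

Lemma rp_all0 z : (forall c : K, rp (c * z) = 0) -> z = 0.
Proof.
move=> /(_ (cj z)); rewrite -av_sqr => /eqP; rewrite sqrf_eq0 => /eqP.
exact: av0_eq0.
Qed.

Lemma sum2 (V : nmodType) (F : 'I_2 -> V) :
  \sum_(i < 2) F i = F ord0 + F ord_max.
Proof.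
by rewrite !big_ord_recl big_ord0 addr0; congr (_ + F _); exact: val_inj.
Qed.

Lemma cV2P u v : u ord0 ord0 = v ord0 ord0 -> u ord_max ord0 = v ord_max ord0 ->
  u = v.
Proof.
move=> e0 e1; apply/matrixP => i j; rewrite !ord1.
case: i => [[|[|//]] p].
  by rewrite (_ : Ordinal p = ord0)//; exact: val_inj.
by rewrite (_ : Ordinal p = ord_max)//; exact: val_inj.
Qed.

Definition ip u v : K :=
  cj (u ord0 ord0) * v ord0 ord0 + cj (u ord_max ord0) * v ord_max ord0.
Definition rip u v : R := rp (ip u v).
Definition nsq u : R := av (u ord0 ord0) ^+ 2 + av (u ord_max ord0) ^+ 2.
Definition nrm u : R := Num.sqrt (nsq u).

Lemma ipDr u v x : ip u (v + x) = ip u v + ip u x.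
Proof. by rewrite /ip !mxE; ring. Qed.

Lemma ipZr u (k : K) v : ip u (k *: v) = k * ip u v.
Proof. by rewrite /ip !mxE; ring. Qed.

Lemma ipC u v : ip v u = cj (ip u v).
Proof. by rewrite /ip rmorphD !rmorphM /= !cjK; ring. Qed.

Lemma ipDl u v x : ip (v + x) u = ip v u + ip x u.
Proof. by rewrite ![ip _ u]ipC ipDr rmorphD. Qed.

Lemma ipZl u (k : K) v : ip (k *: v) u = cj k * ip v u.
Proof. by rewrite ![ip _ u]ipC ipZr rmorphM. Qed.

Lemma ripC u v : rip u v = rip v u.
Proof. by rewrite /rip ipC rp_cj. Qed.

Lemma ripDr u v x : rip u (v + x) = rip u v + rip u x.
Proof. by rewrite /rip ipDr rpD. Qed.

Lemma ripDl u v x : rip (v + x) u = rip v u + rip x u.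
Proof. by rewrite /rip ipDl rpD. Qed.

Lemma ripZr a u v : rip u (emb a *: v) = a * rip u v.
Proof. by rewrite /rip ipZr rp_emb. Qed.

Lemma ripZl a u v : rip (emb a *: u) v = a * rip u v.
Proof. by rewrite ripC ripZr ripC. Qed.

Lemma ripNr u v : rip u (- v) = - rip u v.
Proof. by rewrite -scaleN1r -(rmorphN1 emb) ripZr mulN1r. Qed.

Lemma ripBr u v x : rip u (v - x) = rip u v - rip u x.
Proof. by rewrite ripDr ripNr. Qed.

Lemma nsqE u : emb (nsq u) = ip u u.
Proof. by rewrite rmorphD !av_cj. Qed.

Lemma nsq_rip u : nsq u = rip u u.
Proof. by rewrite /rip -nsqE rp_real. Qed.

Lemma nsq_ge0 u : 0 <= nsq u.
Proof. by rewrite addr_ge0 ?sqr_ge0. Qed.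

Lemma nsq_eq0 u : nsq u = 0 -> u = 0.
Proof.
move=> /eqP; rewrite paddr_eq0 ?sqr_ge0// !sqrf_eq0 => /andP[/eqP u0 /eqP u1].
by apply: cV2P; rewrite mxE; exact: av0_eq0.
Qed.

Lemma nsqZ (k : K) u : nsq (k *: u) = av k ^+ 2 * nsq u.
Proof. by rewrite /nsq !mxE !avM !exprMn mulrDr. Qed.

Lemma nsqN u : nsq (- u) = nsq u.
Proof. by rewrite -scaleN1r nsqZ avN av1; ring. Qed.

Lemma nsqD u v : nsq (u + v) = nsq u + 2 * rip u v + nsq v.
Proof. rewrite !nsq_rip ripDl !ripDr (ripC v u); ring. Qed.

Lemma nsqB u v : nsq (u - v) = nsq u - 2 * rip u v + nsq v.
Proof. by rewrite nsqD nsqN ripNr; ring. Qed.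

Lemma rip_sqr_le u v : rip u v ^+ 2 <= nsq u * nsq v.
Proof.
have [u0|un0] := eqVneq (nsq u) 0.
  rewrite u0 mul0r (nsq_eq0 u0) /rip (_ : ip 0 v = 0) ?rp0 ?expr0n//.
  by rewrite /ip !mxE rmorph0; ring.
have up : 0 < nsq u by rewrite lt_def un0 nsq_ge0.
(* Cauchy-Schwarz: this squared length is |u|^2 (|u|^2 |v|^2 - <u,v>^2). *)
have := nsq_ge0 (emb (nsq u) *: v - emb (rip u v) *: u).
rewrite nsqB !nsqZ !av_emb !real_normK ?num_real// ripZl ripZr (ripC v u) => h.
rewrite -subr_ge0 -(pmulr_rge0 _ up); move: h; congr (0 <= _); ring.
Qed.

Lemma nrm_ge0 u : 0 <= nrm u.
Proof. exact: sqrtr_ge0. Qed.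

Lemma nrm_sqr u : nrm u ^+ 2 = nsq u.
Proof. by rewrite sqr_sqrtr ?nsq_ge0. Qed.

Lemma nrm_le u c : 0 <= c -> (nrm u <= c) = (nsq u <= c ^+ 2).
Proof. by move=> c0; rewrite -nrm_sqr ler_pXn2r ?nnegrE ?nrm_ge0. Qed.

Lemma rip_le u v : rip u v <= nrm u * nrm v.
Proof.
rewrite real_ler_normlW ?num_real// -(@ler_pXn2r _ 2) ?nnegrE ?mulr_ge0 ?nrm_ge0//.
by rewrite real_normK ?num_real// exprMn !nrm_sqr rip_sqr_le.
Qed.

Lemma nrmD u v : nrm (u + v) <= nrm u + nrm v.
Proof.
rewrite nrm_le ?addr_ge0 ?nrm_ge0// nsqD -!nrm_sqr.
have := rip_le u v; nra.
Qed.

Lemma nrmZ (k : K) u : nrm (k *: u) = av k * nrm u.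
Proof. by rewrite /nrm nsqZ sqrtrM ?sqr_ge0// sqrtr_sqr ger0_norm ?av_ge0. Qed.

Definition adj A : 'M[K]_2 := map_mx cj A^T.

Lemma adjP A u v : ip u (A *m v) = ip (adj A *m u) v.
Proof. by rewrite /ip !mxE !sum2 !mxE !rmorphD !rmorphM /= !cjK; ring. Qed.

(** A conjugate-linear quarter turn: for a unit vector [x], the vectors [x] and [perp x] form an
    orthonormal basis. *)
Definition perp u : 'cV[K]_2 :=
  \col_i (if i == ord0 then - cj (u ord_max ord0) else cj (u ord0 ord0)).

Lemma nsq_perp u : nsq (perp u) = nsq u.
Proof. by rewrite /nsq !mxE /= avN !avcj addrC. Qed.

Lemma ip_perp u : ip u (perp u) = 0.
Proof. by rewrite /ip !mxE /=; ring. Qed.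

Lemma ip_perpl u : ip (perp u) u = 0.
Proof. by rewrite ipC ip_perp rmorph0. Qed.

Lemma perp_decomp x u : nsq x = 1 -> u = ip x u *: x + ip (perp x) u *: perp x.
Proof.
move=> x1; have : ip x x = 1 by rewrite -nsqE x1 rmorph1.
rewrite /ip => h; apply: cV2P; rewrite !mxE /= rmorphN !cjK.
  rewrite -[LHS]mulr1 -h; ring.
rewrite -[LHS]mulr1 -h; ring.
Qed.

Lemma nsq_decomp x u : nsq x = 1 ->
  nsq u = av (ip x u) ^+ 2 + av (ip (perp x) u) ^+ 2.
Proof.
move=> x1; rewrite {1}(perp_decomp u x1) nsqD !nsqZ nsq_perp x1 /rip ipZl ipZr.
by rewrite ip_perp !mulr0 rp0; ring.
Qed.

Definition op A : R := opnorm av A.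

(* [c] is the top eigenvalue of [[p, b], [b^*, q]] = A^* A, and
   [al = c - p], [be = c - q] satisfy [al * be = |b|^2]. *)
Lemma nsq_mul_max A : exists c x, [/\ nsq x = 1, nsq (A *m x) = c &
  forall u, nsq (A *m u) <= c * nsq u].
Proof.
pose e i : 'cV[K]_2 := \col_j (j == i)%:R.
pose p := nsq (A *m e ord0); pose q := nsq (A *m e ord_max).
pose b := ip (A *m e ord0) (A *m e ord_max).
have ue u : u = u ord0 ord0 *: e ord0 + u ord_max ord0 *: e ord_max.
  by apply: cV2P; rewrite !mxE /=; ring.
have Au u : nsq (A *m u) = p * av (u ord0 ord0) ^+ 2 + q * av (u ord_max ord0) ^+ 2
    + 2 * rp (cj (u ord0 ord0) * u ord_max ord0 * b).
  rewrite {1}(ue u) mulmxDr -!scalemxAr nsqD !nsqZ /rip ipZl ipZr -/p -/q -/b.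
  by rewrite !mulrA; ring.
pose D := (p - q) ^+ 2 + 4 * av b ^+ 2.
pose s := Num.sqrt D.
have s2 : s ^+ 2 = D.
  rewrite sqr_sqrtr// addr_ge0 ?sqr_ge0// mulr_ge0 ?sqr_ge0//.
have s0 : 0 <= s by exact: sqrtr_ge0.
pose al := (q - p + s) / 2; pose be := (p - q + s) / 2.
have abE : al * be = av b ^+ 2 by rewrite /al /be; move: s2; rewrite /D; nra.
have pqs : `|p - q| <= s.
  rewrite -(@ler_pXn2r _ 2) ?nnegrE ?normr_ge0// real_normK ?num_real// s2.
  by rewrite lerDl mulr_ge0 ?sqr_ge0.
move: (pqs); rewrite ler_norml => /andP[pq1 pq2].
have al0 : 0 <= al by rewrite /al divr_ge0//; lra.
have be0 : 0 <= be by rewrite /be divr_ge0//; lra.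
pose c := (p + q + s) / 2.
have pE : p = c - al by rewrite /c /al; field.
have qE : q = c - be by rewrite /c /be; field.
clearbody al be c.
have ub u : nsq (A *m u) <= c * nsq u.
  rewrite Au /nsq pE qE.
  set X := av _; set Y := av _.
  have X0 : 0 <= X by exact: av_ge0.
  have Y0 : 0 <= Y by exact: av_ge0.
  have : rp (cj (u ord0 ord0) * u ord_max ord0 * b) <= X * Y * av b.
    by apply: le_trans (rp_le_av _) _; rewrite !avM avcj.
  (* Inequality of arithmetic and geometric means, since [al * be] is the square of [av b]. *)
  have : 2 * (X * Y * av b) <= al * X ^+ 2 + be * Y ^+ 2.
    rewrite -(@ler_pXn2r _ 2) ?nnegrE ?mulr_ge0 ?addr_ge0 ?av_ge0 ?mulr_ge0 ?sqr_ge0//.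
    rewrite !exprMn -abE.
    have := sqr_ge0 (al * X ^+ 2 - be * Y ^+ 2); nra.
  by lra.
suff [x x0 xE] : exists2 x, nsq x != 0 & nsq (A *m x) = c * nsq x.
  have xp : 0 < nsq x by rewrite lt_def x0 nsq_ge0.
  have k1 : av (emb (nrm x)^-1) ^+ 2 * nsq x = 1.
    by rewrite av_emb real_normK ?num_real// exprVn nrm_sqr mulVf.
  exists c; exists (emb (nrm x)^-1 *: x); split; [by rewrite nsqZ| |by []].
  by rewrite -scalemxAr nsqZ xE mulrCA k1 mulr1.
(* If [al] vanishes then [c = p] and the first basis vector is maximizing; otherwise (b, al) is an
   eigenvector for [c]. *)
have [a0|a0] := eqVneq al 0.
  exists (e ord0); first by rewrite /nsq !mxE /= av0 av1; apply/eqP; lra.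
  rewrite -/p pE a0 /nsq !mxE /= av0 av1; ring.
exists (\col_i if i == ord0 then b else emb al).
  rewrite /nsq !mxE /= av_emb real_normK ?num_real//.
  rewrite gt_eqF// ltr_wpDl ?sqr_ge0// exprn_gt0// lt_def a0//.
rewrite Au /nsq !mxE /= av_emb real_normK ?num_real// [cj b * _]mulrC -mulrA.
rewrite rp_emb -av_sqr -abE pE qE; ring.
Qed.

(** The explicit maximizer of [nsq_mul_max] stands in for compactness: the supremum is attained,
    which supplies the maximizing vectors used later. *)
Lemma op_spec A : (exists2 x, nsq x = 1 & nrm (A *m x) = op A) /\
  forall u, nrm (A *m u) <= op A * nrm u.
Proof.
have [c [x [x1 xc ub]]] := nsq_mul_max A.
have c0 : 0 <= c by rewrite -xc nsq_ge0.
have opE : op A = Num.sqrt c.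
  rewrite /op /opnorm; set S := (X in sup X).
  have Sc : S (Num.sqrt c).
    by exists x => /=; rewrite sum2 //; congr Num.sqrt.
  have Sub : ubound S (Num.sqrt c).
    move=> _ [u /= u1 <-]; rewrite ler_wsqrtr// !sum2.
    by rewrite sum2 in u1; have := ub u; rewrite /nsq u1 mulr1.
  apply/eqP; rewrite eq_le; apply/andP; split.
    by apply: ge_sup => //; exists (Num.sqrt c).
  by apply: ub_le_sup => //; exists (Num.sqrt c).
split; first by exists x => //; rewrite opE /nrm xc.
by move=> u; rewrite opE /nrm -sqrtrM// ler_wsqrtr.
Qed.

Lemma op_mul A u : nrm (A *m u) <= op A * nrm u.
Proof. by case: (op_spec A). Qed.

Lemma op_le A c : (forall u, nsq u = 1 -> nrm (A *m u) <= c) -> op A <= c.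
Proof. by case: (op_spec A) => -[x x1 <-] _; exact. Qed.

Lemma op_ge0 A : 0 <= op A.
Proof. by case: (op_spec A) => -[x x1 <-] _; exact: nrm_ge0. Qed.

Lemma nrm1 u : nsq u = 1 -> nrm u = 1.
Proof. by rewrite /nrm => ->; rewrite sqrtr1. Qed.

Lemma op_mul1 A u : nsq u = 1 -> nrm (A *m u) <= op A.
Proof. by move=> /nrm1 u1; have := op_mul A u; rewrite u1 mulr1. Qed.

Lemma opD A B : op (A + B) <= op A + op B.
Proof.
apply: op_le => u u1; rewrite mulmxDl; apply: le_trans (nrmD _ _) _.
by rewrite lerD// op_mul1.
Qed.

Lemma opM A B : op (A * B) <= op A * op B.
Proof.
apply: op_le => u u1; rewrite -mulmxA; apply: le_trans (op_mul _ _) _.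
by rewrite ler_wpM2l ?op_ge0// op_mul1.
Qed.

Lemma opZ (k : K) A : op (k *: A) = av k * op A.
Proof.
apply/eqP; rewrite eq_le; apply/andP; split.
  apply: op_le => u u1; rewrite -scalemxAl nrmZ ler_wpM2l ?av_ge0//.
  exact: op_mul1.
case: (op_spec A) => -[x x1 <-] _.
by rewrite -nrmZ scalemxAl; exact: op_mul1.
Qed.

Lemma opN A : op (- A) = op A.
Proof. by rewrite -scaleN1r opZ avN av1 mul1r. Qed.

Lemma opB A B : op (A - B) <= op A + op B.
Proof. by rewrite -[op B]opN; exact: opD. Qed.

Lemma op1 : op 1 = 1.
Proof.
case: (op_spec 1) => -[x x1 <-] _.
by rewrite -[_ *m _]/(1%:M *m x) mul1mx nrm1.
Qed.

Lemma op0 : op 0 = 0.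
Proof. by rewrite -(scale0r (1 : 'M[K]_2)) opZ av0 mul0r. Qed.

Lemma op_eq0 A : op A = 0 -> A = 0.
Proof.
move=> A0; apply/matrixP => i j; rewrite [RHS]mxE.
have : nsq (A *m delta_mx j ord0) = 0.
  apply/eqP; rewrite -nrm_sqr sqrf_eq0 eq_le nrm_ge0 andbT.
  by have := op_mul A (delta_mx j ord0); rewrite A0 mul0r.
by move=> /nsq_eq0; rewrite -colE => /matrixP /(_ i ord0); rewrite !mxE.
Qed.

Lemma opX A n : op (A ^+ n) <= op A ^+ n.
Proof.
elim: n => [|n IH]; first by rewrite !expr0 op1.
rewrite !exprS; apply: le_trans (opM _ _) _.
by rewrite ler_wpM2l ?op_ge0.
Qed.

Lemma I2P (i : 'I_2) : i = ord0 \/ i = ord_max.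
Proof. by case: i => [[|[|//]] p]; [left|right]; exact: val_inj. Qed.

Lemma nsq_delta i : nsq (delta_mx i ord0) = 1.
Proof.
by rewrite /nsq !mxE; case: (I2P i) => -> /=; rewrite av1 av0; ring.
Qed.

Lemma av_entry_le A i j : av (A i j) <= op A.
Proof.
apply: le_trans (op_mul1 A (nsq_delta j)); rewrite -colE.
rewrite -(@ler_pXn2r _ 2) ?nnegrE ?av_ge0 ?nrm_ge0// nrm_sqr /nsq !mxE.
by case: (I2P i) => ->; rewrite ?lerDl ?lerDr sqr_ge0.
Qed.

Lemma op_sum_le (I : Type) (s : seq I) (F : I -> 'M[K]_2) :
  op (\sum_(i <- s) F i) <= \sum_(i <- s) op (F i).
Proof.
elim: s => [|i s IH]; first by rewrite !big_nil op0.
by rewrite !big_cons; apply: le_trans (opD _ _) _; rewrite lerD2l.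
Qed.

Lemma op_delta_le i j : op (delta_mx i j) <= 1.
Proof.
apply: op_le => u u1; rewrite nrm_le// expr1n.
have -> : delta_mx i j *m u = u j ord0 *: delta_mx i ord0.
  apply/matrixP => k l; rewrite !mxE sum2 !mxE !ord1.
  have [->|->] := I2P k; have [->|->] := I2P j; have [->|->] := I2P i => /=;
  ring.
rewrite nsqZ nsq_delta mulr1 -u1 /nsq; case: (I2P j) => ->.
  by rewrite lerDl sqr_ge0.
by rewrite lerDr sqr_ge0.
Qed.

End Hermitian.

(** * The matrix exponential *)

Section TruncatedExponential.
Variables (F : numFieldType) (V : algType F).
Implicit Types (A B : V).

Definition texp n A : V := \sum_(0 <= k < n) k`!%:R^-1 *: A ^+ k.

(** Binomial theorem, arranged as a sum over the triangle i + j < n; the induction adds one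
    antidiagonal at a time. *)
Lemma texpD n A B : GRing.comm A B -> texp n (A + B) =
  \sum_(0 <= i < n) \sum_(0 <= j < n - i) (i`!%:R^-1 * j`!%:R^-1) *: (A ^+ j * B ^+ i).
Proof.
move=> AB; rewrite /texp; elim: n => [|n IH]; first by rewrite !big_geq.
rewrite big_nat_recr //= IH [in RHS]big_nat_recr//= subSnn big_nat1.
rewrite [X in _ = X + _]big_nat [X in _ = X + _](eq_bigr (fun i : nat =>
  \sum_(0 <= j < n - i) (i`!%:R^-1 * j`!%:R^-1) *: (A ^+ j * B ^+ i) +
  (i`!%:R^-1 * (n - i)`!%:R^-1) *: (A ^+ (n - i) * B ^+ i))); last first.
  by move=> i /andP[_ ni]; rewrite subSn ?(ltnW ni)// big_nat_recr.
rewrite -big_nat big_split /= -addrA; congr (_ + _).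
rewrite exprDn_comm// scaler_sumr -(big_mkord xpredT (fun i =>
  n`!%:R^-1 *: (A ^+ (n - i) * B ^+ i *+ 'C(n, i)))).
have E i : (i <= n)%N -> n`!%:R^-1 *: (A ^+ (n - i) * B ^+ i *+ 'C(n, i)) =
    (i`!%:R^-1 * (n - i)`!%:R^-1) *: (A ^+ (n - i) * B ^+ i).
  move=> ni; rewrite -[X in _ *: X](@scaler_nat F) scalerA; congr (_ *: _).
  rewrite -(bin_fact ni) !natrM.
  have f0 m : m`!%:R != 0 :> F by rewrite pnatr_eq0 -lt0n fact_gt0.
  have c0 : 'C(n, i)%:R != 0 :> F by rewrite pnatr_eq0 -lt0n bin_gt0.
  by field; rewrite !f0 c0.
rewrite big_nat_recr//= E// subnn; congr (_ + _).
by apply: eq_big_nat => i /andP[_ /ltnW]; exact: E.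
Qed.

Lemma texpM n A B : texp n A * texp n B =
  \sum_(0 <= i < n) \sum_(0 <= j < n) (i`!%:R^-1 * j`!%:R^-1) *: (A ^+ j * B ^+ i).
Proof.
rewrite exchange_big /= /texp big_distrl /=; apply: eq_bigr => j _.
rewrite big_distrr /=; apply: eq_bigr => i _.
by rewrite -scalerAl -scalerAr scalerA mulrC.
Qed.

(* The coefficients on the right are nonnegative, so that for matrices the norm of
   this difference is dominated by the same difference for their norms. *)
Lemma texpMB n A B : GRing.comm A B -> texp n A * texp n B - texp n (A + B) =
  \sum_(0 <= i < n) \sum_(n - i <= j < n) (i`!%:R^-1 * j`!%:R^-1) *: (A ^+ j * B ^+ i).
Proof.
move=> AB; rewrite texpM texpD// -sumrB; apply: eq_bigr => i _.
by rewrite (@big_cat_nat _ _ _ (n - i)) ?leq_subr//= addrAC subrr add0r.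
Qed.

End TruncatedExponential.

(** * The real exponential series *)

Section ExpR.
Variable R : realType.
Implicit Type a : R.

Lemma texp_cvg a : texp n (a : R^o) @[n --> \oo] --> expR a.
Proof.
have := @is_cvg_series_exp_coeff R a; rewrite /expR.
have -> : series (exp_coeff a) = (fun n => texp n (a : R^o)).
  apply/funext => n; apply: eq_bigr => k _.
  by rewrite /exp_coeff /=; exact: mulrC.
by [].
Qed.

Lemma texp_le a n : 0 <= a -> texp n (a : R^o) <= expR a.
Proof.
move=> a0; have cv : cvgn (fun n => texp n (a : R^o)).
  by apply/cvg_ex; exists (expR a); exact: texp_cvg.
rewrite -(cvg_lim (@Rhausdorff R) (@texp_cvg a)).
apply: nondecreasing_cvgn_le cv _.
apply/nondecreasing_seqP => m; rewrite /texp big_nat_recr//= lerDl.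
by rewrite mulr_ge0 ?invr_ge0 ?exprn_ge0.
Qed.

End ExpR.

(** * Convergence and functional equation of the matrix exponential *)

Section HermitianExp.
Variables (R : realType) (K : numFieldType) (H : hermitian_field R K).
Local Notation emb := (emb H).
Local Notation av := (av H).
Local Notation op := (op H).
Implicit Types (A B C : 'M[K]_2).

Lemma op_le_entries A : op A <= \sum_i \sum_j av (A i j).
Proof.
rewrite {1}[A]matrix_sum_delta; apply: le_trans (op_sum_le _ _ _) _.
apply: ler_sum => i _; apply: le_trans (op_sum_le _ _ _) _.
apply: ler_sum => j _; rewrite opZ -[leRHS]mulr1.
by rewrite ler_wpM2l ?av_ge0 ?op_delta_le.
Qed.

Lemma cvg_av (f : nat -> K) (l : K) e : 0 < e -> f @ \oo --> l ->
  \forall n \near \oo, av (f n - l) <= e.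
Proof.
move=> e0 /cvgrPdist_le /(_ (emb e)) h.
have /h : 0 < emb e by rewrite lt_def -(rmorph0 emb) emb_le ltW// andbT (inj_eq (@emb_inj _ _ H)) gt_eqF.
by apply: filterS => n; rewrite -(av_norm H) emb_le -avN opprB.
Qed.

(** [expm] is a limit in the entrywise topology, whereas the estimates use [op]; the sum of the
    absolute values of the entries bounds [op] and connects the two. *)
Lemma cvg_expm A (L : 'M[K]_2) : (forall i j, texp n A i j @[n --> \oo] --> L i j) ->
  expm A = L /\ forall e, 0 < e -> \forall n \near \oo, op (texp n A - L) <= e.
Proof.
move=> cL; split; last first.
  move=> e e0.
  have h : \forall n \near \oo, forall i j, av ((texp n A - L) i j) <= e / 4.
    apply: filter_forall => i; apply: filter_forall => j.
    near=> n; rewrite !mxE; near: n; apply: cvg_av => //; exact: divr_gt0.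
  apply: filterS h => n h; apply: le_trans (op_le_entries _) _.
  rewrite !sum2 (le_trans (lerD (lerD (h _ _) (h _ _)) (lerD (h _ _) (h _ _))))//.
  lra.
apply: (@cvg_lim 'M[K]_2); first exact: norm_hausdorff.
apply/cvg_ballP => e e0.
have h : \forall n \near \oo, forall i j, ball (L i j) e (texp n A i j).
  apply: filter_forall => i; apply: filter_forall => j.
  have := cL i j => /cvg_ballP; exact.
by apply: filterS h => n h; split.
Unshelve. all: by end_near. Qed.

Lemma op_texp_coeff A k :
  op (k`!%:R^-1 *: A ^+ k) <= k`!%:R^-1 * (op A) ^+ k.
Proof.
by rewrite opZ av_natV ler_wpM2l ?opX// invr_ge0.
Qed.

(** Each entry is dominated by the exponential series of [op A], so [av_complete] provides its
    limit. *)
Lemma expm_approx A e : 0 < e -> \forall n \near \oo, op (texp n A - expm A) <= e.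
Proof.
move=> e0.
have /(_ _)/cid h : forall i, exists Li : 'I_2 -> K, forall j,
    texp n A i j @[n --> \oo] --> Li j.
  move=> i.
  have /(_ _)/cid h : forall j, exists l : K, texp n A i j @[n --> \oo] --> l.
    move=> j; have := @av_complete _ _ H (fun k => (k`!%:R^-1 *: A ^+ k) i j).
    case.
      exists (expR (op A)) => n; apply: le_trans (texp_le n (op_ge0 H A)).
      rewrite /texp big_mkord; apply: ler_sum => k _.
      by apply: le_trans (op_texp_coeff _ _); exact: av_entry_le.
    move=> l cl; exists l.
    rewrite (_ : (fun n => _) = series (fun k => (k`!%:R^-1 *: A ^+ k) i j))//.
    by apply/funext => n; rewrite /texp summxE.
  by exists (fun j => sval (h j)) => j; exact: (svalP (h j)).
pose L := \matrix_(i, j) sval (h i) j.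
have [|-> hL] := @cvg_expm A L; last exact: hL.
by move=> i j; rewrite mxE; exact: (svalP (h i)).
Qed.

Lemma op_lim A (c : R) : (forall e, 0 < e -> op A <= c + e) -> op A <= c.
Proof. by move=> h; apply/ler_addgt0Pr. Qed.

(** The remainder starts at degree 2; factoring out [op A ^+ 2] and using k! <= (k+2)! leaves a
    partial sum of [expR (op A)]. *)
Lemma expm_rem A : op (expm A - 1 - A) <= op A ^+ 2 * expR (op A).
Proof.
apply: op_lim => e e0.
have [N _ hN] := expm_approx A e0.
have {}hN := hN (N + 2)%N (leq_addr _ _).
have -> : expm A - 1 - A = (texp (N + 2) A - 1 - A) - (texp (N + 2) A - expm A).
  by rewrite opprB [RHS]addrC !addrA subrK.
apply: le_trans (opB _ _ _) _; apply: lerD => //.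
have -> : texp (N + 2) A - 1 - A = \sum_(0 <= k < N) (k + 2)`!%:R^-1 *: A ^+ (k + 2).
  rewrite /texp addn2 big_nat_recl//= big_nat_recl//= expr0 expr1 !fact0 invr1 !scale1r.
  have -> S : 1 + (A + S) - 1 - A = S.
    by apply/eqP; rewrite !subr_eq addrC [A + S]addrC.
  by apply: eq_bigr => k _; rewrite addn2.
apply: le_trans (op_sum_le _ _ _) _.
apply: le_trans (_ : \sum_(0 <= k < N) op A ^+ 2 * (k`!%:R^-1 * op A ^+ k) <= _); last first.
  rewrite -mulr_sumr ler_wpM2l ?sqr_ge0//.
  exact: (texp_le N (op_ge0 H A)).
apply: ler_sum => k _; apply: le_trans (op_texp_coeff _ _) _.
rewrite exprD [X in _ * X]mulrC mulrCA ler_wpM2l ?sqr_ge0//.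
rewrite ler_wpM2r ?exprn_ge0 ?op_ge0// lef_pV2 ?posrE ?ltr0n ?fact_gt0//.
by rewrite ler_nat leq_fact// leq_addr.
Qed.

Lemma expm0 : expm (0 : 'M[K]_2) = 1.
Proof.
apply/eqP; rewrite -subr_eq0; apply/eqP; apply: (op_eq0 (H := H)).
apply/eqP; rewrite eq_le op_ge0 andbT.
by have := expm_rem 0; rewrite op0 subr0 expr0n mul0r.
Qed.

Lemma expmD A B : GRing.comm A B -> expm (A + B) = expm A * expm B.
Proof.
move=> AB; apply/eqP; rewrite -subr_eq0; apply/eqP; apply: (op_eq0 (H := H)).
apply/eqP; rewrite eq_le op_ge0 andbT; apply/ler_addgt0Pr => e e0; rewrite add0r.
pose a := op A; pose b := op B.
(* [M] collects the four errors below: two of size [d], one multiplied by [expR a] and one by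
   [op (expm B)]. *)
pose M := op (expm B) + expR a + 2.
have M0 : 0 < M by rewrite /M; have := op_ge0 H (expm B); have := expR_ge0 a; lra.
pose d := e / (3 * M).
have d0 : 0 < d by rewrite divr_gt0// mulr_gt0.
have dM : d * M = e / 3.
  have M1 : M != 0 by rewrite gt_eqF.
  by rewrite /d; clearbody M; field; rewrite M1.
have tE : \forall n \near \oo,
   texp n (a : R^o) * texp n (b : R^o) - texp n (a + b : R^o) <= d.
  have h : (texp n (a : R^o) * texp n (b : R^o) - texp n (a + b : R^o))
     @[n --> \oo] --> expR a * expR b - expR (a + b).
    by apply: cvgB; [apply: cvgM|]; exact: texp_cvg.
  move: h; rewrite expRD subrr => /cvgrPdist_le /(_ _ d0).
  by apply: filterS => n; rewrite sub0r normrN => /ler_normlW.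
have [N1 _ h1'] := expm_approx (A + B) d0; have [N2 _ h2'] := expm_approx A d0.
have [N3 _ h3'] := expm_approx B d0; have [N4 _ h4'] := tE.
pose n := (N1 + N2 + (N3 + N4))%N.
have h1 : op (texp n (A + B) - expm (A + B)) <= d.
  by apply: h1'; rewrite /= /n -addnA leq_addr.
have h2 : op (texp n A - expm A) <= d.
  by apply: h2'; rewrite /= /n (addnC N1) -addnA leq_addr.
have h3 : op (texp n B - expm B) <= d.
  by apply: h3'; rewrite /= /n addnCA leq_addr.
have h4 : texp n (a : R^o) * texp n (b : R^o) - texp n (a + b : R^o) <= d.
  by apply: h4'; rewrite /= /n addnA leq_addl.
clearbody n.
have h5 : op (texp n A * texp n B - texp n (A + B)) <= d.
  apply: le_trans h4; rewrite texpMB// texpMB; last exact: mulrC.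
  apply: le_trans (op_sum_le _ _ _) _; apply: ler_sum => i _.
  apply: le_trans (op_sum_le _ _ _) _; apply: ler_sum => j _.
  rewrite opZ avM !av_natV ler_wpM2l ?mulr_ge0 ?invr_ge0//.
  apply: le_trans (opM H _ _) _.
  exact: ler_pM (op_ge0 _ _) (op_ge0 _ _) (opX H _ _) (opX H _ _).
have h6 : op (texp n A) <= expR a.
  apply: le_trans (texp_le n (op_ge0 H A)).
  apply: le_trans (op_sum_le _ _ _) _; apply: ler_sum => k _.
  exact: op_texp_coeff.
have -> : expm (A + B) - expm A * expm B =
  - (texp n (A + B) - expm (A + B)) - (texp n A * texp n B - texp n (A + B)) +
  (texp n A * (texp n B - expm B) + (texp n A - expm A) * expm B).
  rewrite mulrBr mulrBl !opprB !addrA subrK.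
  by rewrite -[RHS]addrA subrK !addrA subrK.
apply: le_trans (opD _ _ _) _.
apply: le_trans (lerD (opB _ _ _) (opD _ _ _)) _.
rewrite opN.
have h7 : op (texp n A * (texp n B - expm B)) <= expR a * d.
  exact: le_trans (opM H _ _) (ler_pM (op_ge0 _ _) (op_ge0 _ _) h6 h3).
have h8 : op ((texp n A - expm A) * expm B) <= d * op (expm B).
  exact: le_trans (opM H _ _) (ler_pM (op_ge0 _ _) (op_ge0 _ _) h2 (lexx _)).
apply: le_trans (lerD (lerD h1 h5) (lerD h7 h8)) _.
have -> : d + d + (expR a * d + d * op (expm B)) = e / 3.
  by rewrite -dM /M; ring.
clear -e0; lra.
Qed.

Lemma expmN A : expm A * expm (- A) = 1.
Proof. by rewrite -expmD ?subrr ?expm0//; exact: commrN. Qed.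

Lemma expm_sqr0 A : A * A = 0 -> expm A = 1 + A.
Proof.
move=> AA; have [|->//] := @cvg_expm A (1 + A).
move=> i j; apply: cvg_near_cst; exists 2%N => // -[|[|n]]//= _.
rewrite /texp big_nat_recl//= big_nat_recl//= expr0 expr1 !fact0 invr1 !scale1r.
rewrite big1 ?addr0// => k _.
by rewrite !exprS mulrA AA mul0r scaler0.
Qed.

(** All positive powers of [A] equal [A], so only the scalar series without its constant term
    multiplies [A]. The scalar exponential enters as a limit [p], the form in which [log_near1]
    provides it. *)
Lemma expm_idem A (z p : K) : A * A = A ->
  series (fun n => n`!%:R^-1 * z ^+ n) @ \oo --> p ->
  expm (z *: A) = 1 + (p - 1) *: A.
Proof.
move=> AA cp; have [|->//] := @cvg_expm (z *: A) (1 + (p - 1) *: A).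
have AX k : A ^+ k.+1 = A by elim: k => // k IH; rewrite exprS IH.
move=> i j.
apply: cvg_trans (_ : ((1 : 'M[K]_2) i j +
  (series (fun n => n`!%:R^-1 * z ^+ n) n - 1) * A i j) @[n --> \oo] --> _).
  apply: near_eq_cvg; exists 1%N => // -[|n]//= _.
  rewrite /texp /series/= !big_nat_recl//= !expr0 !fact0 invr1 !mulr1 scale1r.
  rewrite [X in X * _]addrAC subrr add0r [RHS]mxE; congr (_ + _).
  rewrite summxE big_distrl; apply: eq_bigr => k _ /=.
  by rewrite exprZn AX scalerA mxE.
rewrite !mxE; apply: cvgD; first exact: cvg_cst.
by apply: cvgM; [apply: cvgB => //; exact: cvg_cst|exact: cvg_cst].
Qed.

End HermitianExp.

(** * Words of exponentials *)

Section Words.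
Variables (R : realType) (K : numFieldType) (H : hermitian_field R K).
Local Notation emb := (emb H).
Local Notation av := (av H).
Local Notation op := (op H).
Implicit Types (A B C D E X g h : 'M[K]_2) (l : seq 'M[K]_2) (U V a b : R -> 'M[K]_2).

(** The head of the list is the leftmost factor, that is, the last letter in time. *)
Definition wexp l : 'M[K]_2 := \prod_(C <- l) expm C.
Definition wlen l : R := \sum_(C <- l) op C.
Definition minimal l := forall l', wexp l' = wexp l -> wlen l <= wlen l'.

Lemma wexp_cat l1 l2 : wexp (l1 ++ l2) = wexp l1 * wexp l2.
Proof. exact: big_cat. Qed.

Lemma wlen_cat l1 l2 : wlen (l1 ++ l2) = wlen l1 + wlen l2.
Proof. exact: big_cat. Qed.

Lemma wexp_cons C l : wexp (C :: l) = expm C * wexp l.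
Proof. exact: big_cons. Qed.

Lemma wlen_cons C l : wlen (C :: l) = op C + wlen l.
Proof. exact: big_cons. Qed.

Lemma wexp_nil : wexp [::] = 1.
Proof. exact: big_nil. Qed.

Lemma wlen_nil : wlen [::] = 0.
Proof. exact: big_nil. Qed.

Lemma minimal_sub l1 l2 l3 : minimal (l1 ++ l2 ++ l3) -> minimal l2.
Proof.
move=> h l' l'2; have := h (l1 ++ l' ++ l3).
by rewrite !wexp_cat l'2 !wlen_cat => /(_ erefl); lra.
Qed.

Lemma minimal_eq l l' : wexp l = wexp l' -> wlen l' <= wlen l ->
  minimal l -> minimal l'.
Proof. by move=> e le h k ke; apply: le_trans le _; apply: h; rewrite e. Qed.

Lemma idem_prod A (p q : K) : A * A = A ->
  (1 + (p - 1) *: A) * (1 + (q - 1) *: A) = 1 + (p * q - 1) *: A.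
Proof.
move=> AA; rewrite mulrDl mul1r mulrDr mulr1 -scalerAl -scalerAr AA scalerA.
rewrite -!addrA; congr (1 + _); rewrite -!scalerDl; congr (_ *: _); ring.
Qed.

(* LDU factorization of [1 + X]. *)
Lemma word_near1 : exists2 c : R, 0 < c & forall X, op X <= 8^-1 ->
  exists2 l, wexp l = 1 + X & wlen l <= c * op X.
Proof.
have [c c0 logc] := log_near1 H.
(* Each off-diagonal letter costs at most [2 * op X]; the logarithms of the two pivots cost
   [c * op X] and [2 * c * op X]. *)
exists (4 + 3 * c) => [|X X8]; first by rewrite addr_gt0// mulr_gt0.
have ent i j : av (X i j) <= op X by exact: av_entry_le.
have X0 : 0 <= op X by exact: op_ge0.
pose k := (1 + X ord0 ord0)^-1.
have k78 : 7 / 8 <= av (1 + X ord0 ord0).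
  have := avD H (1 + X ord0 ord0) (- X ord0 ord0).
  by rewrite addrK av1 avN; have := ent ord0 ord0; lra.
have kn0 : 1 + X ord0 ord0 != 0.
  by apply/eqP => k0; move: k78; rewrite k0 av0; lra.
have k2 : av k <= 2.
  rewrite /k avV -[leRHS]invrK lef_pV2 ?posrE//; lra.
pose l1 := X ord_max ord0 * k; pose l2 := X ord0 ord_max * k.
pose d := X ord_max ord_max - l1 * X ord0 ord_max.
have lk (z : K) : av z <= op X -> av (z * k) <= 2 * op X.
  by move=> zX; rewrite avM mulrC ler_pM ?av_ge0.
have d2 : av d <= 2 * op X.
  apply: le_trans (avD _ _ _) _; rewrite avN avM.
  have : av l1 * av (X ord0 ord_max) <= 2 * op X * op X.
    by rewrite ler_pM ?av_ge0// lk.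
  by have := ent ord_max ord_max; nra.
have [|z1 [z2 [e1 [e2 [ez1 ez2 e12 zc]]]]] := logc (X ord0 ord0).
  by have := ent ord0 ord0; lra.
have [|w1 [w2 [f1 [f2 [ew1 ew2 f12 wc]]]]] := logc d; first by lra.
pose E i j : 'M[K]_2 := delta_mx i j.
have EE i : E i i * E i i = E i i by rewrite /E -[_ * _]/(_ *m _) mul_delta_mx.
exists [:: l1 *: E ord_max ord0; z1 *: E ord0 ord0; z2 *: E ord0 ord0;
   w1 *: E ord_max ord_max; w2 *: E ord_max ord_max; l2 *: E ord0 ord_max].
  rewrite !wexp_cons wexp_nil mulr1.
  rewrite (expm_idem H (EE _) ez1) (expm_idem H (EE _) ez2).
  rewrite (expm_idem H (EE _) ew1) (expm_idem H (EE _) ew2).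
  have NN i j (z : K) : j != i -> expm (z *: E i j) = 1 + z *: E i j.
    move=> ij; apply: (expm_sqr0 H); rewrite -scalerAl -scalerAr.
    by rewrite -[_ * _]/(_ *m _) mul_delta_mx_0// !scaler0.
  rewrite !NN// [X in _ * X = _]mulrA idem_prod// [X in _ * (_ * X) = _]mulrA idem_prod//.
  rewrite e12 f12 ![1 + _ - 1]addrAC subrr !add0r.
  apply/matrixP => i j; rewrite -![_ * _]/(_ *m _) !(mxE, sum2).
  have [->|->] := I2P i; have [->|->] := I2P j; rewrite /= /d /l1 /l2 /k; field;
  exact: kn0.
rewrite !wlen_cons wlen_nil !opZ.
have oE (z : K) i j : av z * op (E i j) <= av z.
  by rewrite -[leRHS]mulr1 ler_wpM2l ?av_ge0 ?op_delta_le.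
have := oE l1 ord_max ord0; have := oE l2 ord0 ord_max.
have := oE z1 ord0 ord0; have := oE z2 ord0 ord0.
have := oE w1 ord_max ord_max; have := oE w2 ord_max ord_max.
have := lk _ (ent ord_max ord0); have := lk _ (ent ord0 ord_max).
have : c * av d <= c * (2 * op X) by rewrite ler_pM2l.
have : c * av (X ord0 ord0) <= c * op X by rewrite ler_pM2l.
rewrite -/l1 -/l2; lra.
Qed.

(** The bound is uniform on (0, 1] rather than near 0, so that constants simply add and multiply. *)
Definition bigo (k : nat) U :=
  exists2 M : R, 0 <= M & forall e : R, 0 < e <= 1 -> op (U e) <= M * e ^+ k.

Lemma bigoD k U V : bigo k U -> bigo k V -> bigo k (fun e => U e + V e).
Proof.
move=> [M M0 hM] [N N0 hN]; exists (M + N) => [|e e01]; first exact: addr_ge0.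
by rewrite mulrDl; apply: le_trans (opD _ _ _) _; rewrite lerD ?hM ?hN.
Qed.

Lemma bigoM k m U V : bigo k U -> bigo m V -> bigo (k + m) (fun e => U e * V e).
Proof.
move=> [M M0 hM] [N N0 hN]; exists (M * N) => [|e e01]; first exact: mulr_ge0.
by rewrite exprD mulrACA; apply: le_trans (opM _ _ _) _; rewrite ler_pM ?op_ge0 ?hM ?hN.
Qed.

Lemma bigo_le k m U : (k <= m)%N -> bigo m U -> bigo k U.
Proof.
move=> km [M M0 hM]; exists M => // e e01; apply: le_trans (hM _ e01) _.
case/andP: e01 => e0 e1.
by rewrite ler_wpM2l// ler_wiXn2l// ltW.
Qed.

Lemma bigoN k U : bigo k U -> bigo k (fun e => - U e).
Proof. by move=> [M M0 hM]; exists M => // e e01; rewrite opN hM. Qed.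

Lemma bigo_cst A : bigo 0 (fun=> A).
Proof. by exists (op A) => [|e _]; rewrite ?op_ge0// expr0 mulr1. Qed.

Lemma bigoZ k A : bigo k (fun e => emb (e ^+ k) *: A).
Proof.
exists (op A) => [|e /andP[e0 _]]; first exact: op_ge0.
by rewrite opZ av_emb ger0_norm ?(exprn_ge0 _ (ltW e0))// mulrC.
Qed.

Lemma bigo_eq k U V : (forall e, U e = V e) -> bigo k U -> bigo k V.
Proof. by move=> UV [M M0 hM]; exists M => // e e01; rewrite -UV hM. Qed.

(* [U = 1 + a + O(e^4)] with [a = O(e^2)]: such expansions multiply additively. *)
Definition approx U a := bigo 2 a /\ bigo 4 (fun e => U e - 1 - a e).

Lemma approx_expm a : bigo 2 a -> approx (fun e => expm (a e)) a.
Proof.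
move=> a2; split => //; case: a2 => M M0 hM.
exists (M ^+ 2 * expR M) => [|e e01].
  by rewrite mulr_ge0 ?expR_ge0 ?sqr_ge0.
apply: le_trans (expm_rem H _) _; have aM := hM _ e01; case/andP: e01 => e0 e1.
have e0' := ltW e0.
rewrite [leRHS]mulrAC (_ : M ^+ 2 * e ^+ 4 = (M * e ^+ 2) ^+ 2); last by ring.
apply: ler_pM; [exact: sqr_ge0|exact: expR_ge0| |].
  by rewrite ler_pXn2r ?nnegrE ?op_ge0 ?mulr_ge0 ?sqr_ge0.
rewrite ler_expR; apply: le_trans aM _.
by rewrite -[leRHS]mulr1 ler_wpM2l// exprn_ile1// ltW.
Qed.

Lemma approx_eq U a b : (forall e, a e = b e) -> approx U a -> approx U b.
Proof.
move=> ab [a2 Ua]; split; first exact: bigo_eq a2.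
by apply: bigo_eq Ua => e; rewrite ab.
Qed.

(** The cross term [a e * b e] is of order 4, hence belongs to the error. *)
Lemma approxM U V a b : approx U a -> approx V b ->
  approx (fun e => U e * V e) (fun e => a e + b e).
Proof.
move=> [a2 Ua] [b2 Vb]; split; first exact: bigoD.
have V0 : bigo 0 V.
  apply: (@bigo_eq _ (fun e => V e - 1 - b e + (b e + 1))).
    by move=> e; rewrite addrA !subrK.
  by apply: bigoD; [|apply: bigoD];
    [exact: bigo_le Vb|exact: bigo_le b2|exact: bigo_cst].
apply: (@bigo_eq _ (fun e => (U e - 1 - a e) * V e + a e * b e +
   (a e * (V e - 1 - b e) + (V e - 1 - b e)))) => [e|]; last first.
  apply: bigoD; apply: bigoD => //.
  - exact: (bigoM Ua V0).
  - exact: (bigoM a2 b2).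
  - by apply: (@bigo_le _ 6) => //; exact: (bigoM a2 Vb).
rewrite !mulrBl !mulrBr mul1r mulr1.
move: (U e * V e) (a e * V e) (a e * b e) (V e) (a e) (b e) => p q r s t u.
by apply/matrixP => i j; rewrite !mxE; ring.
Qed.

Lemma approx_conj g h U a : g * h = 1 -> approx U a ->
  approx (fun e => g * U e * h) (fun e => g * a e * h).
Proof.
move=> gh [a2 Ua].
have bc k V : bigo k V -> bigo k (fun e => g * V e * h).
  move=> Vk; rewrite -[k]addn0; apply: bigoM (bigo_cst h).
  exact: (bigoM (bigo_cst g) Vk).
split; first exact: bc.
apply: bigo_eq (bc _ _ Ua) => e.
by rewrite !mulrBr !mulrBl mulr1 gh.
Qed.


End Words.

(** * First-order variation of a minimal word *)

Section Variation.
Variables (R : realType) (K : numFieldType) (H : hermitian_field R K).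
Local Notation emb := (emb H).
Local Notation op := (op H).
Local Notation wlen := (wlen H).
Local Notation minimal := (minimal H).
Local Notation bigo := (bigo H).
Local Notation approx := (approx H).
Implicit Types (A B C D E : 'M[K]_2).

(* For [op A = 1], [c] is an upper bound of the one-sided derivative of the norm at
   [A] in the direction [D], with quadratic error. *)
Definition dnorm A D (c : R) := exists2 M : R, 0 <= M &
  forall e, 0 < e <= 1 -> op (A + emb e *: D) <= 1 + e * c + M * e ^+ 2.

(** The inverses collected in the defect cancel the perturbed word letter by letter and leave the
    original word. *)
Lemma repair_cancel (S : pzRingType) (a b1 b2 d : S) (g g' h h' x x' y y' z z' : S) :
  x' * x = 1 -> g' * g = 1 -> y' * y = 1 -> h' * h = 1 -> z' * z = 1 ->
  a * (g * (b2 * b1 * (h * (d * z') * h') * y') * g') * x' *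
    (x * (g * (y * (h * (z * 1))))) = a * (g * (b2 * (b1 * (h * (d * 1))))).
Proof.
move=> xx gg yy hh zz.
have can (p p' q : S) : p' * p = 1 -> p' * (p * q) = q.
  by move=> pp; rewrite mulrA pp mul1r.
rewrite -!mulrA (can _ _ _ xx) (can _ _ _ gg) (can _ _ _ yy) (can _ _ _ hh) (can _ _ _ zz).
by [].
Qed.

(* Compare the word with its perturbation of relative size [e] over time slots
   of length [w = e^2]: the products agree up to [O(e^4)], which is repaired by
   a word of length [O(e^4)], while the gain in length is of order [e^3]. *)
Lemma minimal_variation (w0 : R) A B1 B2 E T1 T2 D1 D2 (c1 c0 c2 : R) : 0 < w0 ->
  (forall w, 0 < w <= w0 -> minimal [:: emb w *: A; T1; emb w *: B2;
      emb w *: B1; T2; emb w *: E]) ->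
  op A = 1 -> op B1 = 1 -> op B2 = 1 -> op E = 1 ->
  let D := expm (- T1) * D1 * expm T1 + expm T2 * D2 * expm (- T2) in
  dnorm A D1 c1 -> dnorm E D2 c2 ->
  dnorm (emb 2^-1 *: (B1 + B2)) (- (emb 2^-1 *: D)) c0 ->
  0 <= c1 + 2 * c0 + c2.
Proof.
move=> w00 hmin A1 B11 B21 E1 D [M1 M10 h1] [M2 M20 h2] [M0 M00 h0].
set g := expm T1 in D h1 h2 h0 *; set h := expm T2 in D h1 h2 h0 *.
set g' := expm (- T1) in D h1 h2 h0 *; set h' := expm (- T2) in D h1 h2 h0 *.
have gg' : g * g' = 1 by exact: (expmN H).
have g'g : g' * g = 1 by have := expmN H (- T1); rewrite opprK.
have hh' : h * h' = 1 by exact: (expmN H).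
have h'h : h' * h = 1 by have := expmN H (- T2); rewrite opprK.
(* A velocity change of size [e] over a slot of length [w e] changes the exponent by a multiple of
   [n e]. The two middle letters are fused into [nB]. *)
pose w (e : R) := emb (e ^+ 2); pose n (e : R) := emb (e ^+ 3).
pose nA e := w e *: A + n e *: D1; pose nE e := w e *: E + n e *: D2.
pose nB e := w e *: (B1 + B2) - n e *: D.
have w2 C : bigo 2 (fun e => w e *: C) by exact: bigoZ.
have n2 C : bigo 2 (fun e => n e *: C) by exact: (@bigo_le _ _ H 2 3 _ isT (bigoZ H 3 C)).
have nA2 : bigo 2 nA by exact: bigoD.
have nE2 : bigo 2 nE by exact: bigoD.
have nB2 : bigo 2 nB by apply: bigoD => //; exact: bigoN.
(* The defect [Z], the original product times the inverse of the perturbed one, is assembled from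
   the right end. Conjugation by [h] and [g] carries the changes past [T2] and [T1]; [D] is what
   makes the terms of order [e ^+ 3] cancel. *)
pose Z1 e := expm (w e *: E) * expm (- nE e).
pose Z2 e := h * Z1 e * h'.
pose Z3 e := expm (w e *: B2) * expm (w e *: B1) * Z2 e * expm (- nB e).
pose Z4 e := g * Z3 e * g'.
pose Z e := expm (w e *: A) * Z4 e * expm (- nA e).
have aZ1 : approx Z1 (fun e => - (n e *: D2)).
  apply: (@approx_eq _ _ H _ (fun e => w e *: E + - nE e)) => [e|].
    by rewrite /nE opprD addrA subrr add0r.
  exact: (approxM (approx_expm (w2 E)) (approx_expm (bigoN nE2))).
have aZ2 : approx Z2 (fun e => - (n e *: (h * D2 * h'))).
  apply: approx_eq (approx_conj hh' aZ1) => e.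
  by rewrite mulrN mulNr -scalerAr -scalerAl.
have aZ3 : approx Z3 (fun e => n e *: (g' * D1 * g)).
  apply: (@approx_eq _ _ H _ (fun e => (w e *: B2 + w e *: B1 - n e *: (h * D2 * h')) - nB e)).
    move=> e; rewrite /nB /D; move: (g' * D1 * g) (h * D2 * h') => p q.
    by apply/matrixP => i j; rewrite !mxE; ring.
  apply: approxM (approx_expm (bigoN nB2)).
  exact: (approxM (approxM (approx_expm (w2 B2)) (approx_expm (w2 B1))) aZ2).
have aZ4 : approx Z4 (fun e => n e *: D1).
  apply: approx_eq (approx_conj gg' aZ3) => e.
  by rewrite -scalerAr -scalerAl !mulrA gg' mul1r -!mulrA gg' mulr1.
have aZ : approx Z (fun e => 0).
  apply: (@approx_eq _ _ H _ (fun e => w e *: A + n e *: D1 + - nA e)).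
    by move=> e; rewrite subrr.
  exact: (approxM (approxM (approx_expm (w2 A)) aZ4) (approx_expm (bigoN nA2))).
have [_ [M M00' hM]] := aZ.
have [c c00 hc] := word_near1 H.
have eN C : expm (- C) * expm C = 1 by have := expmN H (- C); rewrite opprK.
have ZE e : Z e * wexp [:: nA e; T1; nB e; T2; nE e] =
    wexp [:: w e *: A; T1; w e *: B2; w e *: B1; T2; w e *: E].
  rewrite !wexp_cons wexp_nil.
  exact: (repair_cancel _ _ _ _ (eN _) g'g (eN _) h'h (eN _)).
pose L := M1 + 2 * M0 + M2 + c * M.
have L0 : 0 <= L by rewrite /L !addr_ge0 ?mulr_ge0// ltW.
have step e : 0 < e -> e <= 1 -> e <= w0 -> M * e <= 8^-1 ->
    0 <= (c1 + 2 * c0 + c2) + L * e.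
  move=> e0 e1 ew eM; have e01 : 0 < e <= 1 by rewrite e0.
  have e41 : e ^+ 4 <= e by rewrite -[leRHS]expr1 ler_wiXn2l// ltW.
  have e21 : e ^+ 2 <= e by rewrite -[leRHS]expr1 ler_wiXn2l// ltW.
  have X8 : op (Z e - 1 - 0) <= M * e ^+ 4 by exact: hM.
  rewrite subr0 in X8.
  have [|l lE ll] := hc (Z e - 1).
    by apply: le_trans X8 _; apply: le_trans eM; rewrite ler_wpM2l.
  have := hmin (e ^+ 2); rewrite exprn_gt0//= (le_trans e21 ew) => /(_ isT).
  move=> /(_ (l ++ [:: nA e; T1; nB e; T2; nE e])).
  rewrite wexp_cat lE [1 + _]addrC subrK ZE => /(_ erefl).
  rewrite wlen_cat !wlen_cons wlen_nil !opZ !av_emb A1 B11 B21 E1.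
  have e2p : 0 < e ^+ 2 by rewrite exprn_gt0.
  rewrite ger0_norm ?(ltW e2p)// !mulr1 !addr0.
  have lenw C D' : op (w e *: C + n e *: D') = e ^+ 2 * op (C + emb e *: D').
    have -> : n e = w e * emb e by rewrite /n /w -rmorphM exprSr.
    rewrite -scalerA -scalerDr opZ av_emb.
    by rewrite ger0_norm ?(ltW e2p).
  have nAe : op (nA e) <= e ^+ 2 * (1 + e * c1 + M1 * e ^+ 2).
    by rewrite /nA lenw ler_pM2l// h1.
  have nEe : op (nE e) <= e ^+ 2 * (1 + e * c2 + M2 * e ^+ 2).
    by rewrite /nE lenw ler_pM2l// h2.
  have nBe : op (nB e) <= 2 * (e ^+ 2 * (1 + e * c0 + M0 * e ^+ 2)).
    rewrite /nB -scalerN lenw.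
    have -> : B1 + B2 + emb e *: - D =
       emb 2 *: (emb 2^-1 *: (B1 + B2) + emb e *: - (emb 2^-1 *: D)).
      move: (B1 + B2) (D) => P Q; apply/matrixP => i j.
      by rewrite !mxE fmorphV rmorph_nat; field.
    rewrite opZ av_emb ger0_norm// mulrCA ler_pM2l// ler_pM2l// h0//.
  have lc : wlen l <= c * (M * e ^+ 4).
    by apply: le_trans ll _; rewrite ler_pM2l.
  move=> hh.
  have : 0 <= e ^+ 3 * (c1 + 2 * c0 + c2 + L * e).
    rewrite /L; move: hh nAe nEe nBe lc.
    have -> : e ^+ 4 = e * e ^+ 3 by ring.
    have -> : e ^+ 3 = e * e ^+ 2 by ring.
    nra.
  by rewrite pmulr_rge0// exprn_gt0.
rewrite leNgt; apply/negP => s0.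
set s := c1 + _ + _ in s0 step.
(* Small enough for the repair, [M * e <= 8^-1], and for [L * e <= - s / 2], which contradicts
   [step] when [s] is negative. *)
pose e := Num.min (Num.min 1 w0) (Num.min (8^-1 / (M + 1)) (- s / (2 * (L + 1)))).
have Mp : 0 < M + 1 by lra.
have Lp : 0 < 2 * (L + 1) by lra.
have e0 : 0 < e.
  by rewrite /e !lt_min ltr01 w00 !divr_gt0//; lra.
have [e1 e2 e3 e4] : [/\ e <= 1, e <= w0, e <= 8^-1 / (M + 1) & e <= - s / (2 * (L + 1))].
  by rewrite /e; split; rewrite !ge_min lexx ?orbT.
clearbody e; move: e3 e4; rewrite !ler_pdivlMr// => e3 e4.
have eM : M * e <= 8^-1 by nra.
have := step e e0 e1 e2 eM; nra.
Qed.

End Variation.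

(** * Directional derivatives of the operator norm *)

Section Geometry.
Variables (R : realType) (K : numFieldType) (H : hermitian_field R K).
Local Notation emb := (emb H).
Local Notation cj := (cj H).
Local Notation av := (av H).
Local Notation op := (op H).
Local Notation ip := (ip H).
Local Notation rip := (rip H).
Local Notation nsq := (nsq H).
Local Notation nrm := (nrm H).
Local Notation perp := (perp H).
Local Notation adj := (adj H).
Local Notation dnorm := (dnorm H).
Local Notation bigo := (bigo H).
Implicit Types (a b c e t : R) (u v x y z : 'cV[K]_2) (A B C D S : 'M[K]_2).

Definition unitary A := adj A * A = 1.

Lemma mulmxx A B u : (A * B) *m u = A *m (B *m u).
Proof. by rewrite mulmxA. Qed.

Lemma mul1v u : (1 : 'M[K]_2) *m u = u.
Proof. exact: mul1mx. Qed.

Lemma eq_on_basis A B x : nsq x = 1 -> A *m x = B *m x ->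
  A *m perp x = B *m perp x -> A = B.
Proof.
move=> x1 ABx ABp; apply/matrixP => i j.
have : A *m delta_mx j ord0 = B *m delta_mx j (ord0 : 'I_1).
  by rewrite (perp_decomp (delta_mx j ord0) x1) !mulmxDr -!scalemxAr ABx ABp.
by rewrite -!colE => /matrixP /(_ i ord0); rewrite !mxE.
Qed.

Lemma contr A u : op A <= 1 -> nsq (A *m u) <= nsq u.
Proof.
move=> A1; rewrite -!nrm_sqr ler_pXn2r ?nnegrE ?nrm_ge0//.
apply: le_trans (op_mul H _ _) _.
by rewrite -[leRHS]mul1r ler_wpM2r ?nrm_ge0.
Qed.

Lemma rip_adj A u v : rip u (A *m v) = rip (adj A *m u) v.
Proof. by rewrite /rip adjP. Qed.

(** The form |z|^2 - |A z|^2 is nonnegative and vanishes at [x], so its polarization with [x]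
    vanishes as well. *)
Lemma adj_max A x : op A <= 1 -> nsq (A *m x) = nsq x ->
  adj A *m (A *m x) = x.
Proof.
move=> A1 Ax.
suff h z : rip (A *m x) (A *m z) = rip x z.
  apply/eqP; rewrite -subr_eq0; apply/eqP; apply: (nsq_eq0 (H := H)).
  set v := _ - x; rewrite nsq_rip {2}/v ripBr ripC -rip_adj h ripC.
  by rewrite subrr.
pose d := rip (A *m x) (A *m z) - rip x z.
pose k := nsq z - nsq (A *m z).
have k0 : 0 <= k by rewrite subr_ge0 contr.
have key t : 2 * (t * d) <= t ^+ 2 * k.
  have := contr (x + emb t *: z) A1.
  rewrite mulmxDr -scalemxAr !nsqD !nsqZ !ripZr av_emb real_normK ?num_real// Ax /d /k.
  nra.
apply/eqP; rewrite -subr_eq0 -/d; apply/eqP.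
have k1 : 0 < k + 1 by lra.
(* This choice of [t] gives 2 (k + 1) d^2 <= k d^2, hence [d = 0]; adding 1 avoids a division by
   zero. *)
have := key (d / (k + 1)).
have -> : 2 * (d / (k + 1) * d) = d ^+ 2 * (2 * (k + 1)) / (k + 1) ^+ 2.
  by field; rewrite gt_eqF.
have -> : (d / (k + 1)) ^+ 2 * k = d ^+ 2 * k / (k + 1) ^+ 2.
  by field; rewrite gt_eqF.
rewrite ler_pM2r ?invr_gt0 ?exprn_gt0// => dk.
apply/eqP; rewrite -sqrf_eq0 eq_le sqr_ge0 andbT.
have := sqr_ge0 d; nra.
Qed.

Lemma ip_max A x z : op A <= 1 -> nsq (A *m x) = nsq x ->
  ip (A *m x) (A *m z) = ip x z.
Proof. by move=> A1 Ax; rewrite adjP adj_max. Qed.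

(** [adj A * A] fixes every maximizing vector, here a whole orthonormal basis. *)
Lemma unitaryP A x : op A <= 1 -> nsq x = 1 -> nsq (A *m x) = 1 ->
  nsq (A *m perp x) = 1 -> unitary A.
Proof.
move=> A1 x1 Ax Ap; apply: (eq_on_basis x1); rewrite mulmxx mul1v adj_max//.
  by rewrite Ax.
by rewrite nsq_perp x1.
Qed.

Lemma unitary_nsq A u : unitary A -> nsq (A *m u) = nsq u.
Proof. by move=> uA; rewrite !nsq_rip rip_adj -mulmxx uA mul1v. Qed.

Lemma unitary_rip A u v : unitary A -> rip (A *m u) (A *m v) = rip u v.
Proof. by move=> uA; rewrite rip_adj -mulmxx uA mul1v. Qed.

Lemma nsq_convex a b u v : a + b = 1 ->
  nsq (emb a *: u + emb b *: v) = a * nsq u + b * nsq v - a * b * nsq (u - v).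
Proof.
move=> ab; rewrite nsqB nsqD !nsqZ !av_emb !real_normK ?num_real// ripZl ripZr.
have -> : b = 1 - a by lra.
ring.
Qed.

Lemma strictly_convex a b u v : 0 < a -> 0 < b -> a + b = 1 ->
  nsq u <= 1 -> nsq v <= 1 -> 1 <= nsq (emb a *: u + emb b *: v) -> u = v.
Proof.
move=> a0 b0 ab u1 v1; rewrite nsq_convex// => h.
apply/eqP; rewrite -subr_eq0; apply/eqP; apply: (nsq_eq0 (H := H)).
apply/eqP; rewrite eq_le nsq_ge0 andbT -(pmulr_rle0 _ (mulr_gt0 a0 b0)).
have := ler_wpM2l (ltW a0) u1; have := ler_wpM2l (ltW b0) v1; lra.
Qed.

Lemma nsq_le_nrm u c : nsq u <= 1 + 2 * c -> nrm u <= 1 + c.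
Proof.
move=> h; have u0 := nsq_ge0 H u.
rewrite nrm_le; last by lra.
by apply: le_trans h _; have := sqr_ge0 c; nra.
Qed.

(** A unit vector with a component of size [b] along [perp x] loses [k * b ^+ 2] in squared length
    under [B], while leaving the line of [x] gains only a multiple of [e * b]. Completing the square
    leaves an error quadratic in [e]. *)
Lemma dnorm_gap B D x : op B <= 1 -> nsq x = 1 -> nsq (B *m x) = 1 ->
  nsq (B *m perp x) < 1 -> dnorm B D (rip (B *m x) (D *m x)).
Proof.
move=> B1 x1 Bx Bp; set y := B *m x; set c := rip y _.
pose k := 1 - nsq (B *m perp x); have k0 : 0 < k by rewrite subr_gt0.
pose d := op D; have d0 : 0 <= d by exact: op_ge0.
(* The first term comes from completing the square, the second from |D z|^2; the halving matches
   [nsq_le_nrm]. *)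
pose M := (16 * d ^+ 2 / k + d ^+ 2) / 2.
have M0 : 0 <= M by rewrite /M divr_ge0// addr_ge0 ?sqr_ge0// divr_ge0 ?(ltW k0)// mulr_ge0 ?sqr_ge0.
exists M => // e /andP[e0 e1]; apply: op_le => z z1.
have -> : 1 + e * c + M * e ^+ 2 = 1 + (e * c + M * e ^+ 2) by ring.
apply: nsq_le_nrm.
rewrite mulmxDl -scalemxAl nsqD nsqZ av_emb real_normK ?num_real// ripZr.
set al := ip x z; set be := ip (perp x) z.
pose a := av al; pose b := av be.
have a0 : 0 <= a by exact: av_ge0.
have b0 : 0 <= b by exact: av_ge0.
have ab : a ^+ 2 + b ^+ 2 = 1 by rewrite -z1 (nsq_decomp z x1).
have a1 : a <= 1 by nra.
have b1 : b <= 1 by nra.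
have zE : z = al *: x + be *: perp x by exact: perp_decomp.
have yBp : ip y (B *m perp x) = 0 by rewrite ip_max// ?Bx// ip_perp.
have nBz : nsq (B *m z) = 1 - k * b ^+ 2.
  rewrite {1}zE mulmxDr -!scalemxAr nsqD !nsqZ -/y Bx /rip ipZl ipZr yBp !mulr0 rp0.
  have a2 : a ^+ 2 = 1 - b ^+ 2 by rewrite -ab addrK.
  rewrite -/a -/b /k a2; ring.
have nDu u : nrm (D *m u) <= d * nrm u by exact: op_mul.
have ny : nrm y = 1 by exact: nrm1.
have nx : nrm x = 1 by exact: nrm1.
have np : nrm (perp x) = 1 by apply: nrm1; rewrite nsq_perp.
have cd : `|c| <= d.
  have := rip_le H y (D *m x); have := rip_le H y (- (D *m x)).
  have -> : nrm (- (D *m x)) = nrm (D *m x) by rewrite /nrm nsqN.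
  rewrite ripNr ny mul1r -/c ler_norml => h1 h2.
  have := nDu x; rewrite nx; lra.
have rDz : rip (B *m z) (D *m z) <= c + 4 * d * b.
  rewrite {1}zE mulmxDr ripDl -!scalemxAr -/y.
  have t1 : rip (be *: (B *m perp x)) (D *m z) <= d * b.
    apply: le_trans (rip_le _ _ _) _; rewrite nrmZ -/b mulrC.
    have : nrm (B *m perp x) <= 1 by rewrite nrm_le// expr1n ltW.
    have := nDu z; rewrite (nrm1 z1) => h1 h2.
    by rewrite ler_pM ?nrm_ge0 ?mulr_ge0 ?nrm_ge0//; [lra|nra].
  have t2 : rip (al *: y) (D *m z) = a ^+ 2 * c + rip (al *: y) (be *: (D *m perp x)).
    rewrite {1}zE mulmxDr ripDr -!scalemxAr; congr (_ + _).
    by rewrite /rip ipZl ipZr mulrA -av_cj rp_emb.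
  have t3 : rip (al *: y) (be *: (D *m perp x)) <= d * b.
    apply: le_trans (rip_le _ _ _) _; rewrite !nrmZ -/a -/b ny mulr1.
    have := nDu (perp x); rewrite np mulr1 => h1.
    have h0 := nrm_ge0 H (D *m perp x).
    have : b * nrm (D *m perp x) <= d * b by rewrite mulrC ler_wpM2r.
    have : 0 <= b * nrm (D *m perp x) by rewrite mulr_ge0.
    clear -a0 a1; move: (b * _) => q; nra.
  have t4 : a ^+ 2 * c <= c + d * b.
    have -> : a ^+ 2 = 1 - b ^+ 2 by rewrite -ab addrK.
    move: cd; rewrite ler_norml => /andP[c1 c2].
    have : b * (- c) <= b * d by rewrite ler_wpM2l// lerNl.
    have : b ^+ 2 * (- c) <= b ^+ 2 * d by rewrite ler_wpM2l ?sqr_ge0// lerNl.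
    have : b ^+ 2 * d <= b * d by rewrite ler_wpM2r// expr2 -[leRHS]mulr1 ler_wpM2l.
    lra.
  have db0 : 0 <= d * b by exact: mulr_ge0.
  rewrite t2 -mulrA; lra.
have nDz : nsq (D *m z) <= d ^+ 2.
  have := nDu z; rewrite (nrm1 z1) mulr1 -nrm_sqr => h.
  by rewrite ler_pXn2r ?nnegrE ?nrm_ge0.
rewrite nBz.
have s1 : 2 * (e * rip (B *m z) (D *m z)) <= 2 * (e * (c + 4 * d * b)).
  by rewrite ler_pM2l// ler_pM2l.
have s2 : e ^+ 2 * nsq (D *m z) <= e ^+ 2 * d ^+ 2 by rewrite ler_wpM2l ?sqr_ge0.
have s3 : 8 * (e * d * b) - k * b ^+ 2 <= e ^+ 2 * (16 * d ^+ 2 / k).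
  rewrite -subr_ge0.
  have -> : e ^+ 2 * (16 * d ^+ 2 / k) - (8 * (e * d * b) - k * b ^+ 2) =
    (4 * e * d - k * b) ^+ 2 / k by field; rewrite gt_eqF.
  by rewrite divr_ge0 ?sqr_ge0// ltW.
have -> : 1 + 2 * (e * c + M * e ^+ 2) = 1 + 2 * (e * c) + (e ^+ 2 * (16 * d ^+ 2 / k)
   + e ^+ 2 * d ^+ 2) by rewrite /M; field; rewrite gt_eqF.
move: s1 s2 s3; clear; move: (e ^+ 2 * nsq _) (e ^+ 2 * d ^+ 2) (e ^+ 2 * (16 * _ / _)).
move=> p q r; have -> : 2 * (e * (c + 4 * d * b)) = 2 * (e * c) + 8 * (e * d * b) by ring.
lra.
Qed.

(** For antihermitian [S] the vector [S *m z] is orthogonal to [z] in the real inner product, so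
    [1 + e S] changes lengths only to second order. *)
Lemma dnorm_unitary B S : unitary B -> adj S = - S -> dnorm B (B * S) 0.
Proof.
move=> uB aS; exists (op S ^+ 2) => [|e /andP[e0 e1]]; first exact: sqr_ge0.
apply: op_le => z z1; rewrite mulr0 addr0; apply: nsq_le_nrm.
have -> : (B + emb e *: (B * S)) *m z = B *m (z + emb e *: (S *m z)).
  by rewrite mulmxDl mulmxDr -scalemxAl mulmxx scalemxAr.
rewrite unitary_nsq// nsqD nsqZ ripZr z1 av_emb real_normK ?num_real//.
have -> : rip z (S *m z) = 0.
  have := rip_adj S z z; rewrite aS mulNmx [RHS]ripC ripNr; lra.
have : nsq (S *m z) <= op S ^+ 2.
  by rewrite -nrm_sqr ler_pXn2r ?nnegrE ?nrm_ge0 ?op_ge0// op_mul1.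
have := sqr_ge0 e; have := sqr_ge0 (op S); nra.
Qed.

(** With [c = 0] this covers an unperturbed letter; with [c > 0] it turns a norm deficit into a
    negative slope, since [e <= 1]. *)
Lemma dnorm_cst A c : 0 <= c -> op A <= 1 - c -> dnorm A 0 (- c).
Proof.
move=> c0 Ac; exists 0 => // e /andP[e0 e1].
rewrite scaler0 addr0 mul0r addr0; apply: le_trans Ac _.
by rewrite lerD2l mulrN lerN2 -[leRHS]mul1r ler_wpM2r.
Qed.

(** The conjugated matrix has the commutator as its derivative at 0; all other terms contain two
    small factors or an exponential remainder. *)
Lemma bigo_conj B D : bigo 2 (fun t => expm (- (emb t *: B)) * D * expm (emb t *: B)
  - D - emb t *: (D * B - B * D)).
Proof.
have e2 C : bigo 2 (fun t => expm (emb t *: C) - 1 - emb t *: C).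
  exists (op C ^+ 2 * expR (op C)) => [|t /andP[t0 t1]].
    by rewrite mulr_ge0 ?sqr_ge0 ?expR_ge0.
  apply: le_trans (expm_rem H _) _; rewrite opZ av_emb ger0_norm ?(ltW t0)//.
  have C0 := op_ge0 H C.
  have -> : op C ^+ 2 * expR (op C) * t ^+ 2 = (t * op C) ^+ 2 * expR (op C) by ring.
  rewrite ler_wpM2l ?sqr_ge0// ler_expR.
  by rewrite -[leRHS]mul1r ler_wpM2r.
have eB := e2 B; have eN := e2 (- B).
have b1 C : bigo 1 (fun t => emb t *: C).
  by apply: bigo_eq (bigoZ H 1 C) => t; rewrite expr1.
have eB0 : bigo 0 (fun t => expm (emb t *: B)).
  apply: (@bigo_eq _ _ H _ (fun t => expm (emb t *: B) - 1 - emb t *: B +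
     (emb t *: B + 1))) => [t|]; first by rewrite addrA !subrK.
  apply: bigoD; first exact: (@bigo_le _ _ H 0 2 _ isT eB).
  by apply: bigoD; [exact: (@bigo_le _ _ H 0 1 _ isT (b1 B))|exact: bigo_cst].
have c0 C : bigo 0 (fun=> C) by exact: bigo_cst.
apply: (@bigo_eq _ _ H _ (fun t =>
  (expm (emb t *: - B) - 1 - emb t *: - B) * (D * expm (emb t *: B)) +
  (D * (expm (emb t *: B) - 1 - emb t *: B) +
  ((emb t *: - B) * (D * (expm (emb t *: B) - 1 - emb t *: B)) +
   (emb t *: - B) * (D * (emb t *: B)))))).
  move=> t; rewrite scalerN; move: (expm _) (expm _) => P Q.
  rewrite -mulrA; set X := D * P.
  rewrite !mulrBl !mulrBr !mulNr -!scalerAl -!scalerAr !mul1r !mulr1 -/X.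
  rewrite ?mulrN.
  clearbody X; set p := Q * X; set q := B * X; set r := D * B; set s := B * D.
  set u := B * r; clearbody p q u r s.
  by apply/matrixP => i j; rewrite !mxE; ring.
apply: bigoD; first exact: (bigoM eN (bigoM (c0 D) eB0)).
apply: bigoD; first exact: (bigoM (c0 D) eB).
apply: bigoD.
  apply: (@bigo_le _ _ H 2 3) => //.
  exact: (bigoM (b1 (- B)) (bigoM (c0 D) eB)).
exact: (bigoM (b1 (- B)) (bigoM (c0 D) (b1 B))).
Qed.

Lemma rip_le_op A x y : nsq x = 1 -> nsq y = 1 -> rip y (A *m x) <= op A.
Proof.
move=> /nrm1 x1 /nrm1 y1; apply: le_trans (rip_le _ _ _) _.
by rewrite y1 mul1r; have := op_mul H A x; rewrite x1 mulr1.
Qed.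

(** On [0, t0] the pairing of [y] with the conjugated direction is largest at [t = 0], so its right
    derivative there is nonpositive. *)
Lemma conj_derivative_le0 B D x y t0 : nsq x = 1 -> nsq y = 1 -> 0 < t0 ->
  (forall t, 0 < t <= t0 ->
    rip y ((expm (- (emb t *: B)) * D * expm (emb t *: B)) *m x) <= rip y (D *m x)) ->
  rip y ((D * B - B * D) *m x) <= 0.
Proof.
move=> x1 y1 t00 ht; rewrite leNgt; apply/negP; set q := rip _ _ => q0.
have [M M0 hM] := bigo_conj B D.
have M1 : 0 < M + 1 by lra.
(* The last bound makes the linear term [t * q] exceed the remainder [M * t ^+ 2]. *)
pose t := Num.min (Num.min 1 t0) (q / (2 * (M + 1))).
have t_gt0 : 0 < t by rewrite !lt_min ltr01 t00 divr_gt0// mulr_gt0.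
have [t1 tt0 tq] : [/\ t <= 1, t <= t0 & t <= q / (2 * (M + 1))].
  by split; rewrite !ge_min lexx ?orbT.
clearbody t.
have := hM t; rewrite t_gt0 t1 => /(_ isT).
set G := (_ - _ - _) => oG.
have := ht t; rewrite t_gt0 tt0 => /(_ isT).
have -> : expm (- (emb t *: B)) * D * expm (emb t *: B) =
    G + (emb t *: (D * B - B * D)) + D by rewrite /G !subrK.
clearbody G; rewrite 2!mulmxDl 2!ripDr -scalemxAl ripZr -/q.
have : - op G <= rip y (G *m x).
  have := rip_le_op (- G) x1 y1; rewrite opN mulNmx ripNr; lra.
move: tq; rewrite ler_pdivlMr; last by rewrite mulr_gt0.
clearbody q; move: oG q0 M0 t_gt0; clear => oG q0 M0 t_gt0.
move: (rip _ _) (rip _ _) => r s tq rG rs.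
have tp : 0 < t ^+ 2 by rewrite exprn_gt0.
have : M * t ^+ 2 >= 0 by rewrite mulr_ge0// ltW.
have : t * (t * (2 * (M + 1))) <= t * q by rewrite ler_pM2l.
have -> : t * (t * (2 * (M + 1))) = 2 * (M * t ^+ 2) + 2 * t ^+ 2 by ring.
lra.
Qed.

Definition outer u v : 'M[K]_2 := \matrix_(i, j) (u i ord0 * cj (v j ord0)).

Lemma outerE u v z : outer u v *m z = ip v z *: u.
Proof.
apply/matrixP => i j; rewrite !mxE sum2 !mxE !ord1 /ip; ring.
Qed.

Lemma adj_outer u v : adj (outer u v) = outer v u.
Proof. by apply/matrixP => i j; rewrite !mxE rmorphM /= cjK mulrC. Qed.

Lemma adjK A : adj (adj A) = A.
Proof. by apply/matrixP => i j; rewrite !mxE cjK. Qed.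

Lemma adjB A B : adj (A - B) = adj A - adj B.
Proof. by apply/matrixP => i j; rewrite !mxE rmorphB. Qed.

(** A contraction with a unimodular eigenvalue at [x] also preserves the orthogonal line, so both
    matrices are diagonal in the basis [x], [perp x]. *)
Lemma eigen_commute A B x (k : K) : nsq x = 1 -> av k = 1 -> op A <= 1 ->
  op B <= 1 -> A *m x = k *: x -> B *m x = k *: x -> A * B = B * A.
Proof.
move=> x1 k1 A1 B1 Ax Bx.
have k0 : cj k != 0.
  by apply/eqP => k0; move: k1; rewrite -avcj k0 av0 => /eqP; rewrite eq_sym oner_eq0.
have diag C : op C <= 1 -> C *m x = k *: x ->
    exists c : K, C *m perp x = c *: perp x.
  move=> C1 Cx; exists (ip (perp x) (C *m perp x)); rewrite {1}(perp_decomp (C *m perp x) x1).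
  have : ip (C *m x) (C *m perp x) = 0.
    by rewrite ip_max ?ip_perp// Cx nsqZ k1; ring.
  rewrite Cx ipZl => /eqP; rewrite mulf_eq0 (negPf k0)/= => /eqP ->.
  by rewrite scale0r add0r.
apply: (eq_on_basis x1); rewrite !mulmxx.
  by rewrite Ax Bx -!scalemxAr Ax Bx.
have [a Ap] := diag _ A1 Ax; have [b Bp] := diag _ B1 Bx.
by rewrite Ap Bp -!scalemxAr Ap Bp !scalerA mulrC.
Qed.

End Geometry.

(** * Structure of minimal words *)


Section MinimalWords.
Variables (R : realType) (K : numFieldType) (H : hermitian_field R K).
Local Notation emb := (emb H).
Local Notation cj := (cj H).
Local Notation rp := (rp H).
Local Notation av := (av H).
Local Notation op := (op H).
Local Notation ip := (ip H).
Local Notation rip := (rip H).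
Local Notation nsq := (nsq H).
Local Notation perp := (perp H).
Local Notation adj := (adj H).
Local Notation unitary := (unitary H).
Local Notation outer := (outer H).
Local Notation dnorm := (dnorm H).
Local Notation minimal := (minimal H).
Implicit Types (a b c e s t : R) (u v x y z : 'cV[K]_2) (A B C D S : 'M[K]_2).

Lemma emb_half (V : lmodType K) (v : V) : emb 2^-1 *: (v + v) = v.
Proof.
rewrite scalerDr -scalerDl -rmorphD (_ : 2^-1 + 2^-1 = 1 :> R); last by field.
by rewrite rmorph1 scale1r.
Qed.

Lemma expm_emb_split a b C (T : 'M[K]_2) :
  expm (emb (a + b) *: C) * T = expm (emb a *: C) * (expm (emb b *: C) * T).
Proof.
rewrite rmorphD scalerDl (expmD H) ?mulrA//.
by rewrite /GRing.comm -!scalerAl -!scalerAr !scalerA mulrC.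
Qed.

Lemma expm_emb_split4 a b c e C (T : 'M[K]_2) :
  expm (emb (a + b + c + e) *: C) * T = expm (emb a *: C) *
    (expm (emb b *: C) * (expm (emb c *: C) * (expm (emb e *: C) * T))).
Proof.
apply: etrans (expm_emb_split _ _ _ _) _.
by apply: etrans (expm_emb_split _ _ _ _) _; exact: expm_emb_split.
Qed.

(** Both letters are cut into slots [w], [t], [w] adjacent to the junction, and the outer remainders
    are dropped. This is the shape treated by [minimal_variation]. *)
Lemma pair_refine A B s1 s2 t w : op A = 1 -> op B = 1 ->
  0 < t -> 0 < w -> t + 2 * w <= s1 -> t + 2 * w <= s2 ->
  minimal [:: emb s2 *: A; emb s1 *: B] ->
  minimal [:: emb w *: A; emb t *: A; emb w *: A; emb w *: B; emb t *: B; emb w *: B].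
Proof.
move=> A1 B1 t0 w0 ts1 ts2 hm.
have [r1 r10 s1E] : exists2 r, 0 <= r & s1 = w + t + w + r.
  by exists (s1 - (t + 2 * w)); [rewrite subr_ge0|ring].
have [r2 r20 s2E] : exists2 r, 0 <= r & s2 = r + w + t + w.
  by exists (s2 - (t + 2 * w)); [rewrite subr_ge0|ring].
set l := [:: _; _; _; _; _; _].
apply: (@minimal_sub _ _ _ [:: emb r2 *: A] l [:: emb r1 *: B]).
apply: minimal_eq hm; rewrite /l /= !(wexp_cons, wlen_cons, wexp_nil, wlen_nil).
  rewrite s1E s2E; apply: etrans (expm_emb_split4 _ _ _ _ _ _) _.
  by congr (_ * (_ * (_ * (_ * _)))); exact: expm_emb_split4.
rewrite !opZ !av_emb A1 B1 !ger0_norm; lra.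
Qed.

Section Pair.
Variables (A B : 'M[K]_2) (s1 s2 : R).
Hypotheses (A1 : op A = 1) (B1 : op B = 1) (s10 : 0 < s1) (s20 : 0 < s2).
Hypothesis hmin : minimal [:: emb s2 *: A; emb s1 *: B].

(** For [t] and [w] up to [s0], the length [t + 2 * w] fits into either letter. *)
Let s0 := Num.min s1 s2 / 4.

Lemma pair_step_gt0 : 0 < s0.
Proof. by rewrite divr_gt0// lt_min s10. Qed.

(** The changes occur at distance [t] on either side of the junction, and [D] is the sum of their
    transports to the junction. *)
Lemma pair_variation t (D1 D2 : 'M[K]_2) (c1 c0 c2 : R) : 0 < t <= s0 ->
  let D := expm (- (emb t *: A)) * D1 * expm (emb t *: A) +
           expm (emb t *: B) * D2 * expm (- (emb t *: B)) in
  dnorm A D1 c1 -> dnorm B D2 c2 ->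
  dnorm (emb 2^-1 *: (B + A)) (- (emb 2^-1 *: D)) c0 ->
  0 <= c1 + 2 * c0 + c2.
Proof.
move=> /andP[t0 ts] D h1 h2 h0.
apply: (minimal_variation pair_step_gt0 _ A1 B1 A1 B1 h1 h2 h0) => w /andP[w0 ws].
have [m1 m2] : Num.min s1 s2 <= s1 /\ Num.min s1 s2 <= s2.
  by rewrite !ge_min !lexx orbT.
apply: pair_refine hmin => //; move: ts ws; rewrite /s0; lra.
Qed.

Lemma pair_common_max : exists2 x, nsq x = 1 & A *m x = B *m x /\ nsq (A *m x) = 1.
Proof.
pose C := emb 2^-1 *: (B + A).
(* Otherwise replacing both letters near the junction by their mean, with no other change, would
   shorten the word. *)
have C1 : 1 <= op C.
  rewrite leNgt; apply/negP => C1.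
  have c0 : 0 <= 1 - op C by rewrite subr_ge0 ltW.
  have hC : dnorm C 0 (- (1 - op C)) by apply: dnorm_cst => //; lra.
  have h0 X : op X = 1 -> dnorm X 0 (- 0) by move=> X1; apply: dnorm_cst; rewrite ?X1//; lra.
  have s00 : 0 < s0 <= s0 by rewrite pair_step_gt0 lexx.
  have := @pair_variation s0 0 0 _ (- (1 - op C)) _ s00 (h0 _ A1) (h0 _ B1).
  rewrite !mulr0 !mul0r addr0 scaler0 oppr0 => /(_ hC); lra.
have [[x x1 Cx] _] := op_spec H C; exists x => //.
have nA : nsq (A *m x) <= 1 by rewrite -x1 contr// A1.
have nB : nsq (B *m x) <= 1 by rewrite -x1 contr// B1.
have E : A *m x = B *m x.
  apply: (@strictly_convex _ _ H 2^-1 2^-1) => //; first by lra.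
  rewrite -scalerDr -mulmxDl scalemxAl addrC -/C -nrm_sqr Cx.
  by rewrite -[leLHS](expr1n _ 2) ler_pXn2r ?nnegrE ?op_ge0.
split=> //; apply/eqP; rewrite eq_le nA/=.
have -> : A *m x = C *m x.
  by rewrite /C -scalemxAl mulmxDl E emb_half.
by rewrite -nrm_sqr Cx -[leLHS](expr1n _ 2) ler_pXn2r ?nnegrE ?op_ge0.
Qed.

End Pair.

Lemma minimal_single_eigen B s x : 0 < s -> op B = 1 -> minimal [:: emb s *: B] ->
  nsq x = 1 -> nsq (B *m x) = 1 -> ~ unitary B ->
  B *m x = ip x (B *m x) *: x.
Proof.
move=> s0 B1 hm x1 Bx nU; set y := B *m x.
have B1' : op B <= 1 by rewrite B1.
have gap : nsq (B *m perp x) < 1.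
  rewrite lt_neqAle -{2}x1 -(nsq_perp H x) contr// andbT.
  by apply/negP => /eqP /(unitaryP B1' x1 Bx).
have dB D := dnorm_gap D B1' x1 Bx gap.
have half : 0 < s / 2 by rewrite divr_gt0.
(* One letter is viewed as two equal halves, so that the variation of pairs applies. *)
have hm2 : minimal [:: emb (s / 2) *: B; emb (s / 2) *: B].
  apply: minimal_eq hm; rewrite !(wexp_cons, wlen_cons, wexp_nil, wlen_nil).
    have {1}-> : s = s / 2 + s / 2 by field.
    exact: expm_emb_split.
  rewrite !opZ !av_emb B1 !ger0_norm ?(ltW s0) ?(ltW half)//; lra.
have BB : emb 2^-1 *: (B + B) = B by exact: emb_half.
(* For this direction the commutator term is |<perp x, y>|^2, so its nonpositivity puts [y] on the
   line of [x]. *)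
pose D := outer (perp x) (perp x).
have key : rip y ((D * B - B * D) *m x) <= 0.
  apply: (conj_derivative_le0 x1 Bx (pair_step_gt0 half half)) => t ht.
  set G := _ * D * _.
  have := pair_variation B1 B1 half half hm2 ht (dB D) (dnorm_cst (lexx 0) _).
  rewrite mulr0 mul0r addr0 BB -/G subr0 => /(_ _ B1') h.
  have := h _ (dB _); rewrite mulNmx ripNr -scalemxAl ripZr -/y.
  have -> : 2 * - (2^-1 * rip y (G *m x)) = - rip y (G *m x) by field.
  lra.
move: key; rewrite mulmxBl ripBr !mulmxx -/y !outerE ip_perpl scale0r mulmx0.
rewrite /rip ipZr (ipC H (perp x) y) mulrC -av_sqr.
have -> : ip y 0 = 0 by rewrite /ip !mxE !mulr0 addr0.
rewrite rp0 subr0 => h.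
have h0 : ip (perp x) y = 0.
  apply: (av0_eq0 (H := H)); apply/eqP; rewrite -sqrf_eq0 eq_le sqr_ge0 andbT//.
by rewrite {1}(perp_decomp y x1) h0 scale0r addr0.
Qed.

(* The conclusion is the eigenvector equation [(U + adj U) *m x = rho *: x]
   multiplied by [U]. *)
Lemma unitary_real_part U x (r t0 : R) : unitary U -> nsq x = 1 -> r != 0 -> 0 < t0 ->
  (forall S t, adj S = - S -> 0 < t <= t0 ->
     rip (U *m x) ((expm (- (emb t *: (emb r *: U))) * (U * S) *
       expm (emb t *: (emb r *: U))) *m x) <= 0) ->
  U *m (U *m x) = (ip x (U *m x) + ip (U *m x) x) *: (U *m x) - x.
Proof.
move=> uU x1 r0 t00 hS; set y := U *m x.
have y1 : nsq y = 1 by rewrite /y unitary_nsq.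
have key S : adj S = - S -> r * rip x (S *m y - U *m (S *m x)) <= 0.
  move=> aS; have := @conj_derivative_le0 _ _ H (emb r *: U) (U * S) x y t0 x1 y1 t00.
  have -> : (U * S * (emb r *: U) - emb r *: U * (U * S)) *m x =
     emb r *: (U *m (S *m y - U *m (S *m x))).
    rewrite -scalerAl -scalerAr -scalerBr -scalemxAl mulmxBl mulmxBr.
    by rewrite !mulmxx.
  rewrite ripZr unitary_rip//; apply => t ht.
  have -> : rip y ((U * S) *m x) = 0.
    rewrite mulmxx unitary_rip//.
    have := rip_adj H S x x; rewrite aS mulNmx [RHS]ripC ripNr; lra.
  exact: hS.
(* [q] is the inner product of [y + adj U *m x] with [perp x]. *)
pose q := ip y (perp x) + ip x (U *m perp x).
have key2 (k : K) : r * rp (k * q) >= 0.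
  (* An antihermitian matrix moving [x] towards [perp x]; using both [k] and [- k] turns the
     inequality into [rp (k * q) = 0]. *)
  pose S := k *: outer (perp x) x - cj k *: outer x (perp x).
  have aS : adj S = - S.
    have adjZ (l : K) C : adj (l *: C) = cj l *: adj C.
      by apply/matrixP => i j; rewrite !mxE rmorphM.
    by rewrite /S adjB !adjZ !adj_outer cjK opprB.
  have := key S aS.
  have Sz z : S *m z = (k * ip x z) *: perp x - (cj k * ip (perp x) z) *: x.
    by rewrite mulmxBl -!scalemxAl !outerE !scalerA.
  rewrite !Sz ip_perpl mulr0 scale0r subr0 -nsqE x1 rmorph1 mulr1.
  rewrite !ripBr /rip !ipZr ip_perp mulr0 rp0 -nsqE x1 rmorph1 mulr1 -scalemxAr ipZr.
  have -> : rp (k * q) = rp (cj k * ip (perp x) y) + rp (k * ip x (U *m perp x)).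
    by rewrite /q mulrDr rpD (ipC H (perp x) y) -(rp_cj H (k * cj _)) rmorphM cjK.
  lra.
have q0 : q = 0.
  apply: (rp_all0 (H := H)) => k.
  have h1 := key2 k; have := key2 (- k); rewrite mulNr rpN mulrN => h2.
  have : r * rp (k * q) == 0 by rewrite eq_le h1 -oppr_ge0 h2.
  by rewrite mulf_eq0 (negPf r0) => /eqP.
have UU : U * adj U = 1 by exact: (mulmx1C uU).
pose v := y + adj U *m x.
have vx : v = ip x v *: x.
  rewrite {1}(perp_decomp v x1).
  suff -> : ip (perp x) v = 0 by rewrite scale0r addr0.
  rewrite -[LHS](cjK H) -ipC /v ipDl -adjP [_ + _]q0 rmorph0//.
have : U *m v = ip x v *: y by rewrite {1}vx -scalemxAr.
rewrite /v mulmxDr -mulmxx UU mul1v ipDr adjP adjK => <-.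
by rewrite addrK.
Qed.

Lemma minimal_pair_comm A B s1 s2 : op A = 1 -> op B = 1 -> 0 < s1 -> 0 < s2 ->
  minimal [:: emb s2 *: A; emb s1 *: B] -> A * B = B * A.
Proof.
move=> A1 B1 s10 s20 hm.
have [x x1 [ABx Ax]] := pair_common_max A1 B1 s10 s20 hm.
have Bx : nsq (B *m x) = 1 by rewrite -ABx.
have A1' : op A <= 1 by rewrite A1.
have B1' : op B <= 1 by rewrite B1.
set y := A *m x in ABx Ax.
have fin (k : K) : y = k *: x -> A * B = B * A.
  move=> yk; apply: (@eigen_commute _ _ H _ _ x k x1 _ A1' B1'); rewrite -?ABx -?yk//.
  have := Ax; rewrite yk nsqZ x1 mulr1 => /eqP; rewrite sqrf_eq1 => /orP[/eqP//|/eqP h].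
  by have := av_ge0 H k; rewrite h; lra.
have hmA : minimal [:: emb s2 *: A].
  exact: (@minimal_sub _ _ _ [::] [:: _] [:: _] hm).
have hmB : minimal [:: emb s1 *: B].
  exact: (@minimal_sub _ _ _ [:: _] [:: _] [::] hm).
have [uA|nA] := pselect (unitary A); last first.
  exact: (fin _ (minimal_single_eigen s20 A1 hmA x1 Ax nA)).
have [uB|nB] := pselect (unitary B); last first.
  by apply: (fin (ip x y)); rewrite ABx; exact: (minimal_single_eigen s10).
have [->//|AB] := eqVneq A B.
pose C := emb 2^-1 *: (B + A).
have C1 : op C <= 1.
  rewrite /C opZ av_emb ger0_norm//.
  have := opD H B A; rewrite A1 B1 => h.
  by rewrite ler_pdivrMl//; lra.
have Cx : C *m x = y.
  by rewrite /C -scalemxAl mulmxDl -ABx emb_half.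
(* If the mean also preserved the length of [perp x], strict convexity would make [A] and [B] agree
   on a basis. *)
have gap : nsq (C *m perp x) < 1.
  rewrite ltNge; apply/negP => h; move/eqP: AB; apply.
  apply: (eq_on_basis x1) => //.
  have px : nsq (perp x) <= 1 by rewrite nsq_perp x1.
  apply: (@strictly_convex _ _ H 2^-1 2^-1) => //; first by lra.
  - exact: le_trans (contr _ A1') px.
  - exact: le_trans (contr _ B1') px.
  - by rewrite -scalerDr -mulmxDl scalemxAl addrC.
have dC D : dnorm C D (rip y (D *m x)).
  by rewrite -Cx; apply: dnorm_gap => //; rewrite Cx.
have h0 X : op X = 1 -> dnorm X 0 0.
  by move=> X1; rewrite -[X in dnorm _ _ X]oppr0; apply: dnorm_cst; rewrite ?X1//; lra.
have t00 := pair_step_gt0 s10 s20.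
have c2 (p : R) : 2 * - (2^-1 * p) = - p by field.
have hA : A *m y = (ip x y + ip y x) *: y - x.
  apply: (unitary_real_part uA x1 (oner_neq0 R) t00) => S t aS ht.
  rewrite rmorph1 scale1r -/y.
  have := pair_variation A1 B1 s10 s20 hm ht (dnorm_unitary uA aS) (h0 _ B1) (dC _).
  rewrite mulr0 mul0r !addr0 mulNmx ripNr -scalemxAl ripZr c2; lra.
have hB : B *m y = (ip x y + ip y x) *: y - x.
  (* The transport from the right letter to the junction conjugates in the opposite direction, hence
     [r := -1]. *)
  rewrite ABx; apply: (unitary_real_part uB x1 (r := -1) _ t00) => [|S' t aS ht].
    by rewrite oppr_eq0 oner_neq0.
  rewrite rmorphN1 scaleN1r scalerN opprK -ABx.
  have := pair_variation A1 B1 s10 s20 hm ht (h0 _ A1) (dnorm_unitary uB aS) (dC _).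
  rewrite mulr0 mul0r !add0r mulNmx ripNr -scalemxAl ripZr c2; lra.
have [p0|p0] := eqVneq (ip (perp x) y) 0.
  by apply: (fin (ip x y)); rewrite {1}(perp_decomp y x1) p0 scale0r addr0.
move/eqP: AB => []; apply: (eq_on_basis x1) => //.
(* [A] and [B] agree on [x] and, by [hA] and [hB], on [y]; [perp x] is a combination of these
   two. *)
have E C' : C' *m perp x = (ip (perp x) y)^-1 *: (C' *m y - ip x y *: (C' *m x)).
  rewrite {2}(perp_decomp y x1) mulmxDr -!scalemxAr [X in X - _]addrC addrK.
  by rewrite scalerA mulVf// scale1r.
by rewrite (E A) (E B) hA hB -ABx.
Qed.

Theorem minimal_structure (l : seq (R * 'M[K]_2)) : l != [::] ->
  (forall p, p \in l -> 0 < p.1 /\ op p.2 = 1) ->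
  minimal [seq emb p.1 *: p.2 | p <- l] ->
  (exists2 U, unitary U & forall p, p \in l -> p.2 = U) \/
  (exists x (k : K), [/\ nsq x = 1, av k = 1 & forall p, p \in l -> p.2 *m x = k *: x]).
Proof.
(* Induction on the length, because the merged word is not a sublist. *)
elim: {l}(size l) {-2}l (erefl (size l)) => [[]//|n IH] [//|[s2 A] l] /= [ln] _ hl hm.
have [s20 A1] : 0 < s2 /\ op A = 1 by apply: (hl (s2, A)); rewrite inE eqxx.
case: l ln hl hm => [|[s1 B] l] ln hl hm.
  have [[x x1 Ax] _] := op_spec H A.
  have Ax1 : nsq (A *m x) = 1 by rewrite -nrm_sqr Ax A1 expr1n.
  have [uA|nA] := pselect (unitary A).
    by left; exists A => // p; rewrite inE => /eqP ->.
  have E := minimal_single_eigen s20 A1 hm x1 Ax1 nA.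
  right; exists x, (ip x (A *m x)); split => //.
    apply/eqP; rewrite -(@eqrXn2 _ 2) ?av_ge0// expr1n; apply/eqP.
    by rewrite -Ax1 [in RHS]E nsqZ x1 mulr1.
  by move=> p; rewrite inE => /eqP ->.
have [s10 B1] : 0 < s1 /\ op B = 1 by apply: (hl (s1, B)); rewrite !inE eqxx orbT.
have hpair : minimal [:: emb s2 *: A; emb s1 *: B].
  exact: (@minimal_sub _ _ _ [::] [:: _; _] _ hm).
have AB := minimal_pair_comm A1 B1 s10 s20 hpair.
have com : GRing.comm (emb s2 *: A) (emb s1 *: B).
  by rewrite /GRing.comm -!scalerAl -!scalerAr AB !scalerA mulrC.
pose s := s2 + s1; have s0 : 0 < s by exact: addr_gt0.
pose a := s2 / s; pose b := s1 / s.
have a0 : 0 < a by exact: divr_gt0.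
have b0 : 0 < b by exact: divr_gt0.
have ab : a + b = 1 by rewrite /a /b -mulrDl mulfV// gt_eqF.
pose C := emb a *: A + emb b *: B.
have sC : emb s *: C = emb s2 *: A + emb s1 *: B.
  rewrite scalerDr !scalerA -!rmorphM /a /b.
  by rewrite ![s * _]mulrC !divfK// gt_eqF.
have oAB : op (emb s2 *: A) = s2 /\ op (emb s1 *: B) = s1.
  by rewrite !opZ !av_emb A1 B1 !mulr1 !ger0_norm ?ltW.
(* Merging preserves the product, so by minimality it cannot shorten the word and the triangle
   inequality is an equality. *)
have C1 : op C = 1.
  have sCs : op (emb s *: C) = s.
    apply/eqP; rewrite eq_le; apply/andP; split.
      by rewrite sC; apply: le_trans (opD _ _ _) _; rewrite oAB.1 oAB.2.
    have := hpair [:: emb s *: C]; rewrite !(wexp_cons, wlen_cons, wexp_nil, wlen_nil).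
    rewrite oAB.1 oAB.2 !mulr1 !addr0; apply.
    by rewrite sC (expmD H com).
  move: sCs; rewrite opZ av_emb ger0_norm ?ltW// => /(canRL (mulKf (lt0r_neq0 s0))) ->.
  by rewrite mulVf// gt_eqF.
have hm' : minimal [seq emb p.1 *: p.2 | p <- (s, C) :: l].
  apply: minimal_eq hm; rewrite /= !(wexp_cons, wlen_cons).
    by rewrite sC (expmD H com) mulrA.
  by rewrite oAB.1 oAB.2 opZ av_emb C1 ger0_norm ?(ltW s0)// mulr1 addrA.
have hl' p : p \in (s, C) :: l -> 0 < p.1 /\ op p.2 = 1.
  by rewrite inE => /orP[/eqP ->//|pl]; apply: hl; rewrite !inE pl !orbT.
case: (IH ((s, C) :: l) ln isT hl' hm').
- move=> [U uU hU]; have CU := hU (s, C) (mem_head _ _); rewrite /= in CU.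
  (* [C *m z] is a unit vector and a proper convex combination of [A *m z] and [B *m z], which lie
     in the unit ball; hence these coincide. *)
  have ABE z : nsq z = 1 -> A *m z = B *m z.
    move=> z1; apply: (strictly_convex (H := H) a0 b0 ab).
    - by rewrite -z1 contr// A1.
    - by rewrite -z1 contr// B1.
    - by rewrite !scalemxAl -mulmxDl -/C CU unitary_nsq// z1.
  have ABeq : A = B.
    by apply: (eq_on_basis (nsq_delta H ord0)); apply: ABE; rewrite ?nsq_perp nsq_delta.
  have AU : A = U by rewrite -CU /C -ABeq -scalerDl -rmorphD ab rmorph1 scale1r.
  left; exists U => // p; rewrite !inE => /or3P[/eqP ->//|/eqP ->|pl] /=.
  + by rewrite -ABeq.
  + by apply: hU; rewrite inE pl orbT.
- move=> [x [k [x1 k1 hx]]]; have Cx := hx (s, C) (mem_head _ _); rewrite /= in Cx.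
  have ABx : A *m x = B *m x.
    apply: (strictly_convex (H := H) a0 b0 ab).
    - by rewrite -x1 contr// A1.
    - by rewrite -x1 contr// B1.
    - by rewrite !scalemxAl -mulmxDl -/C Cx nsqZ k1 x1 expr1n mulr1.
  have Ax : A *m x = k *: x.
    rewrite -Cx /C mulmxDl -!scalemxAl -ABx -scalerDl -rmorphD ab rmorph1.
    by rewrite scale1r.
  right; exists x, k; split => // p; rewrite !inE => /or3P[/eqP ->//|/eqP ->|pl] /=.
  + by rewrite -ABx.
  + by apply: hx; rewrite inE pl orbT.
Qed.

End MinimalWords.

(** * The real and complex cases *)

Section MagnusExponent.
Variables (R : realType) (K : numFieldType) (H : hermitian_field R K).

Lemma magnus_le_wlen (l : seq 'M[K]_2) : l != [::] ->
  magnus (av H) (wexp l) <= wlen H l.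
Proof.
move=> l0; apply: ge_inf.
  exists 0 => _ [m [C [_ _ ->]]]; apply: sumr_ge0 => i _; exact: op_ge0.
exists (size l), (fun i => nth 0 l (rev_ord i)); split.
- by rewrite lt0n size_eq0.
- rewrite /wexp (big_nth 0) big_mkord; apply: eq_bigr => i _.
  by rewrite rev_ordK.
- rewrite /wlen (big_nth 0) big_mkord (reindex_inj rev_ord_inj).
  by apply: eq_bigr => i _.
Qed.

Theorem magnus_extremal (k : nat) (s : 'I_k -> R) (B : 'I_k -> 'M[K]_2) :
  (0 < k)%N -> (forall i, 0 < s i) -> (forall i, op H (B i) = 1) ->
  magnus (av H) (prod_exp (fun i => emb H (s i)) B) = \sum_(i < k) s i ->
  (exists2 U, unitary H U & forall i, B i = U) \/
  (exists x c, [/\ nsq H x = 1, av H c = 1 & forall i, B i *m x = c *: x]).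
Proof.
move=> k0 s0 B1 hM.
pose l := [seq (s (rev_ord i), B (rev_ord i)) | i <- index_enum 'I_k].
have mem_l i : (s i, B i) \in l.
  by apply/mapP; exists (rev_ord i); rewrite ?mem_index_enum// rev_ordK.
have hl p : p \in l -> 0 < p.1 /\ op H p.2 = 1 by move=> /mapP[i _ ->] /=.
have l0 : l != [::] by apply/eqP => l0; have := mem_l (Ordinal k0); rewrite l0.
have wl : wlen H [seq emb H p.1 *: p.2 | p <- l] = \sum_(i < k) s i.
  rewrite /wlen !big_map /= (reindex_inj rev_ord_inj); apply: eq_bigr => i _.
  by rewrite rev_ordK opZ av_emb B1 mulr1 ger0_norm ?ltW.
have wx : wexp [seq emb H p.1 *: p.2 | p <- l] = prod_exp (fun i => emb H (s i)) B.
  by rewrite /wexp !big_map.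
have hm : minimal H [seq emb H p.1 *: p.2 | p <- l].
  move=> l'; rewrite wl wx -hM => <-.
  (* The Magnus exponent requires [m >= 1]; the empty word is replaced by the single letter 0, with
     the same product and length. *)
  case: l' => [|C l']; last exact: magnus_le_wlen.
  have := @magnus_le_wlen [:: 0] isT.
  by rewrite wexp_cons (expm0 H) mul1r wlen_cons op0 add0r.
have [[U uU hU]|[x [c [x1 c1 hx]]]] := minimal_structure l0 hl hm.
  by left; exists U => // i; have := hU _ (mem_l i).
by right; exists x, c; split => // i; have := hx _ (mem_l i).
Qed.

(** [V] is the adjoint of the matrix with columns [x] and [perp x]. It depends on [x] alone, so one
    change of basis serves all letters. *)
Lemma diagonalize (x : 'cV[K]_2) : nsq H x = 1 ->
  exists V : 'M[K]_2, adj H V *m V = 1%:M /\ forall (A : 'M[K]_2) (c : K),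
    op H A <= 1 -> av H c = 1 -> A *m x = c *: x ->
    exists d, V *m A *m invmx V = diag2 c d.
Proof.
move=> x1; have [p [p1 xp px dec]] : exists p, [/\ nsq H p = 1, ip H x p = 0,
    ip H p x = 0 & forall u, u = ip H x u *: x + ip H p u *: p].
  exists (perp H x); rewrite nsq_perp x1 ip_perp ip_perpl; split => // u.
  exact: perp_decomp.
pose W : 'M[K]_2 := row_mx x p.
have W0 i : W i ord0 = x i ord0.
  rewrite /W mxE; case: splitP => j //=; rewrite ord1 => _; by [].
have W1 i : W i ord_max = p i ord0.
  rewrite /W mxE; case: splitP => j //=; rewrite ord1; by [].
clearbody W; pose V := adj H W.
have VW : V *m W = 1%:M.
  have e (u v : 'cV[K]_2) : cj H (u ord0 ord0) * v ord0 ord0 + cj H (u ord_max ord0) * v ord_max ord0 = ip H u v by [].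
  apply/matrixP => i j; rewrite !mxE sum2 !mxE.
  have [->|->] := I2P i; have [->|->] := I2P j; rewrite !(W0, W1) e /=.
  - by rewrite -nsqE x1 rmorph1.
  - exact: xp.
  - exact: px.
  - by rewrite -nsqE p1 rmorph1.
have WV := mulmx1C VW.
exists V; split; first by rewrite adjK.
move=> A c A1 c1 Ax; have c0 : cj H c != 0.
  by apply/eqP => c0; move: c1; rewrite -avcj c0 av0 => /eqP; rewrite eq_sym oner_eq0.
have [d Ap] : exists d : K, A *m p = d *: p.
  exists (ip H p (A *m p)); rewrite {1}(dec (A *m p)).
  have : ip H (A *m x) (A *m p) = 0.
    by rewrite ip_max// Ax nsqZ c1; ring.
  rewrite Ax ipZl => /eqP; rewrite mulf_eq0 (negPf c0)/= => /eqP ->.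
  by rewrite scale0r add0r.
exists d.
have -> : invmx V = W.
  have uV : V \in unitmx by case: (mulmx1_unit VW).
  by rewrite -[invmx V]mulmx1 -VW mulmxA mulVmx// mul1mx.
have AW : A *m W = W *m diag2 c d.
  have AxE i : (A *m x) i ord0 = c * x i ord0 by rewrite Ax mxE.
  have ApE i : (A *m p) i ord0 = d * p i ord0 by rewrite Ap mxE.
  apply/matrixP => i j; have := AxE i; have := ApE i; rewrite /diag2 !mxE !sum2 !mxE.
  have [->|->] := I2P j; rewrite !(W0, W1) /=; [move=> _ ->|move=> -> _]; ring.
by rewrite -mulmxA AW mulmxA VW mul1mx.
Qed.

End MagnusExponent.

(** * The real numbers as a Hermitian field *)

Section RealInstance.
Variable R : realType.

Lemma real_series_cvg (u : nat -> R) :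
  (exists M, forall n, \sum_(k < n) `|u k| <= M) -> exists l : R, series u @ \oo --> l.
Proof.
move=> [M hM]; exists (limn (series u)); apply: normed_cvg.
apply: nondecreasing_is_cvgn.
  by apply/nondecreasing_seqP => n; rewrite /normed_series_of /series /= big_nat_recr//= lerDl.
by exists M => _ [n _ <-]; rewrite /normed_series_of /series /= big_mkord.
Qed.

(** Both bounds on the logarithm come from [1 + z <= expR z], applied to [z] and to [- z]. *)
Lemma ln1D_le (y : R) : `|y| <= 4^-1 -> expR (ln (1 + y)) = 1 + y /\ `|ln (1 + y)| <= 2 * `|y|.
Proof.
move=> y4; have := y4; rewrite ler_norml => /andP[y1 y2].
have yp : 0 < 1 + y by lra.
have E : expR (ln (1 + y)) = 1 + y by rewrite lnK.
split => //; set z := ln _ in E *.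
have h1 : 1 + z <= 1 + y by rewrite -E; exact: expR_ge1Dx.
have h2 : (1 + - z) * (1 + y) <= 1.
  have := expR_ge1Dx (- z); rewrite expRN E => h.
  by rewrite -ler_pdivlMr// div1r.
rewrite ler_norml; have := ler_norm y; have := ler_norm (- y); rewrite normrN.
move: h1 h2 y1 y2; clear; move: `|y| => a; move=> *; apply/andP; split; nra.
Qed.

Lemma exp_series_cvg (x : R) :
  series (fun n => n`!%:R^-1 * x ^+ n) @ \oo --> expR x.
Proof.
have := @texp_cvg R x.
by rewrite (_ : (fun n => texp n _) = series (fun n => n`!%:R^-1 * x ^+ n)).
Qed.

Lemma real_log (y : R) : `|y| <= 4^-1 ->
  exists z1 z2 e1 e2 : R, [/\ series (fun n => n`!%:R^-1 * z1 ^+ n) @ \oo --> e1,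
      series (fun n => n`!%:R^-1 * z2 ^+ n) @ \oo --> e2,
      e1 * e2 = 1 + y & `|z1| + `|z2| <= 2 * `|y|].
Proof.
(* There is no phase in the real case, so the second exponent is 0. *)
move=> /ln1D_le[E hz]; exists (ln (1 + y)), 0, (1 + y), 1; split.
- by have := @exp_series_cvg (ln (1 + y)); rewrite E.
- by have := @exp_series_cvg 0; rewrite expR0.
- by rewrite mulr1.
- by rewrite normr0 addr0.
Qed.

(** Kept transparent so that [op] and [magnus] for this instance are convertible to [opnormR] and
    [magnusR]. *)
Definition real_field : hermitian_field R R.
Proof.
apply: (@HermitianField R R idfun idfun id (fun x => `|x|)) => //=.
- by move=> z; rewrite -expr2 real_normK ?num_real.
- exact: real_series_cvg.
- by exists 2 => // y; exact: real_log.
Defined.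

End RealInstance.

(** * The complex numbers as a Hermitian field *)

Section ComplexInstance.
Variable R : realType.
Local Notation C := (R[i] : numFieldType).

Lemma cabsE (z : C) : cabs z = Num.sqrt (complex.Re z ^+ 2 + complex.Im z ^+ 2).
Proof. by rewrite /cabs normc_def. Qed.

Lemma cabs_norm (z : C) : (cabs z)%:C%C = `|z|.
Proof. by rewrite /cabs normc_def. Qed.

Lemma cabs_Re (z : C) : `|complex.Re z| <= cabs z.
Proof. by rewrite cabsE -sqrtr_sqr ler_wsqrtr// lerDl sqr_ge0. Qed.

Lemma cabs_Im (z : C) : `|complex.Im z| <= cabs z.
Proof. by rewrite cabsE -sqrtr_sqr ler_wsqrtr// lerDr sqr_ge0. Qed.

Lemma cabs_le (z : C) : cabs z <= `|complex.Re z| + `|complex.Im z|.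
Proof.
rewrite cabsE -(@ler_pXn2r _ 2) ?nnegrE ?sqrtr_ge0 ?addr_ge0//.
rewrite sqr_sqrtr ?addr_ge0 ?sqr_ge0//.
rewrite sqrrD !real_normK ?num_real//.
have : 0 <= `|complex.Re z| * `|complex.Im z| by rewrite mulr_ge0.
rewrite mulr2n; lra.
Qed.

Lemma cvg_complex (u : nat -> C) (a b : R) :
  (complex.Re (u n) @[n --> \oo] --> a) -> (complex.Im (u n) @[n --> \oo] --> b) ->
  u @ \oo --> ((a +i* b)%C : C).
Proof.
move=> ha hb; apply/cvgrPdist_le => e e0.
(* In the order of [R[i]] a positive element is real. *)
have [r r0 eE] : exists2 r : R, 0 < r & e = r%:C%C.
  exists (complex.Re e); first by move: e0; rewrite ltcE => /andP[].
  by rewrite RRe_real// gtr0_real.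
have r2 : 0 < r / 2 by rewrite divr_gt0.
move/cvgrPdist_le: ha => /(_ _ r2) ha; move/cvgrPdist_le: hb => /(_ _ r2) hb.
case: ha => N1 _ hN1; case: hb => N2 _ hN2.
exists (N1 + N2)%N => //= n /= Nn; rewrite eE -cabs_norm lecR.
apply: le_trans (cabs_le _) _.
have -> : r = r / 2 + r / 2 by field.
have := hN1 n (leq_trans (leq_addr _ _) Nn); have := hN2 n (leq_trans (leq_addl _ _) Nn).
by case: (u n) => p q /= h1 h2; exact: lerD.
Qed.


Lemma complex_series_cvg (u : nat -> C) :
  (exists M, forall n, \sum_(k < n) cabs (u k) <= M) -> exists l : C, series u @ \oo --> l.
Proof.
move=> [M hM].
have [|a ha] := @real_series_cvg R (fun n => complex.Re (u n)).
  by exists M => n; apply: le_trans (hM n); apply: ler_sum => k _; exact: cabs_Re.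
have [|b hb] := @real_series_cvg R (fun n => complex.Im (u n)).
  by exists M => n; apply: le_trans (hM n); apply: ler_sum => k _; exact: cabs_Im.
exists (a +i* b)%C; apply: cvg_complex.
- rewrite (_ : (fun n => _) = series (fun n => complex.Re (u n)))//.
  by apply/funext => n; rewrite /series/= (raddf_sum (@complex.Re R : Rcomplex R -> R)).
- rewrite (_ : (fun n => _) = series (fun n => complex.Im (u n)))//.
  by apply/funext => n; rewrite /series/= (raddf_sum (@complex.Im R : Rcomplex R -> R)).
Qed.

Lemma atan_le (x : R) : 0 <= x -> `|atan x| <= x.
Proof.
rewrite le_eqVlt => /predU1P[<-|x0]; first by rewrite atan0 normr0.
have [|c _] := @MVT R atan (fun y => (1 + y ^+ 2)^-1) 0 x x0 (fun y _ => is_derive1_atan y).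
  by apply: continuous_subspaceT => y; exact: continuous_atan.
rewrite atan0 !subr0 => ->.
have c0 : 0 < 1 + c ^+ 2 by rewrite ltr_pwDl// sqr_ge0.
rewrite normrM ger0_norm ?invr_ge0 ?(ltW c0)// gtr0_norm// ler_piMl ?(ltW x0)//.
by rewrite invf_le1// lerDl sqr_ge0.
Qed.

Lemma real_complex_natV n : (n%:R^-1 : C) = (n%:R^-1 : R)%:C%C.
Proof. by rewrite (fmorphV (real_complex R)) (rmorph_nat (real_complex R)). Qed.

(** Written to match the coefficients of cosine and sine; at [n = 0] the truncated predecessor is
    harmless because [odd n] is false. *)
Lemma imag_expr (t : R) n : ((0 +i* t)%C : C) ^+ n =
  (((~~ odd n)%:R * (-1) ^+ n./2 * t ^+ n) +i* ((odd n)%:R * (-1) ^+ n.-1./2 * t ^+ n))%C.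
Proof.
elim: n => [|n IH]; first by rewrite !expr0 /= !mul0r !mulr1.
rewrite exprSr IH; apply/eqP; rewrite eq_complex /= negbK; apply/andP; split.
  case: n {IH} => [|n]; first by rewrite /=; apply/eqP; ring.
  by rewrite /= negbK uphalf_half !exprS; case: (odd n) => /=; apply/eqP; rewrite ?add0n ?exprS; ring.
by rewrite !exprS; apply/eqP; ring.
Qed.

Lemma exp_series_imag (t : R) :
  series (fun n => n`!%:R^-1 * ((0 +i* t)%C : C) ^+ n) @ \oo --> ((cos t +i* sin t)%C : C).
Proof.
have E n : n`!%:R^-1 * ((0 +i* t)%C : C) ^+ n = (cos_coeff t n +i* sin_coeff t n)%C.
  rewrite real_complex_natV imag_expr cos_coeffE sin_coeffE; apply/eqP.
  by rewrite eq_complex /= !mul0r subr0 addr0; apply/andP; split; apply/eqP; ring.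
apply: cvg_complex.
- rewrite (_ : (fun n => _) = series (cos_coeff t)).
    by rewrite cos.unlock; exact: is_cvg_series_cos_coeff.
  apply/funext => n; rewrite /series/= (raddf_sum (@complex.Re R : Rcomplex R -> R)).
  by apply: eq_bigr => k _; rewrite E.
- rewrite (_ : (fun n => _) = series (sin_coeff t)).
    by rewrite sin.unlock; exact: is_cvg_series_sin_coeff.
  apply/funext => n; rewrite /series/= (raddf_sum (@complex.Im R : Rcomplex R -> R)).
  by apply: eq_bigr => k _; rewrite E.
Qed.

Lemma exp_series_real (t : R) :
  series (fun n => n`!%:R^-1 * (t%:C%C : C) ^+ n) @ \oo --> ((expR t)%:C%C : C).
Proof.
have E n : n`!%:R^-1 * (t%:C%C : C) ^+ n = (n`!%:R^-1 * t ^+ n)%:C%C.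
  by rewrite real_complex_natV -(rmorphXn (real_complex R)) -(rmorphM (real_complex R)).
apply: cvg_complex.
- rewrite (_ : (fun n => _) = series (fun n => n`!%:R^-1 * t ^+ n)).
    exact: exp_series_cvg.
  apply/funext => n; rewrite /series/= (raddf_sum (@complex.Re R : Rcomplex R -> R)).
  by apply: eq_bigr => k _; rewrite E.
- rewrite (_ : (fun n => _) = (fun=> 0)); first exact: cvg_cst.
  apply/funext => n; rewrite /series/= (raddf_sum (@complex.Im R : Rcomplex R -> R)).
  by rewrite big1// => k _; rewrite E.
Qed.

(** Polar form: the real part of [1 + y] is at least 3/4, so the phase is the arctangent of
    imaginary over real part. Modulus and phase each contribute at most [2 * cabs y]. *)
Lemma complex_log (y : C) : cabs y <= 4^-1 ->
  exists z1 z2 e1 e2 : C, [/\ series (fun n => n`!%:R^-1 * z1 ^+ n) @ \oo --> e1,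
      series (fun n => n`!%:R^-1 * z2 ^+ n) @ \oo --> e2,
      e1 * e2 = 1 + y & cabs z1 + cabs z2 <= 4 * cabs y].
Proof.
move=> y4; pose al := 1 + complex.Re y; pose be := complex.Im y.
have yE : 1 + y = (al +i* be)%C.
  by rewrite /al /be; case: (y) => p q; apply/eqP; rewrite eq_complex /= add0r !eqxx.
have := cabs_Re y; have := cabs_Im y; rewrite -/be !ler_norml.
move=> /andP[b1 b2] /andP[a1 a2].
have al0 : 3 / 4 <= al by rewrite /al; lra.
have alp : 0 < al by lra.
pose r := cabs (1 + y).
have rn : `|r - 1| <= cabs y.
  rewrite ler_norml; apply/andP; split.
    rewrite lerBrDl -lecR rmorphD/= rmorphN /= !cabs_norm.
    by have := lerB_normD 1 y; rewrite normr1.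
  rewrite lerBlDl -lecR rmorphD/= !cabs_norm.
  by have := ler_normD 1 y; rewrite normr1.
have [lnr lnb] := @ln1D_le R (r - 1) (le_trans rn y4).
have r1E : 1 + (r - 1) = r by ring.
rewrite r1E in lnr lnb.
pose x := be / al; pose ph := atan x.
have rE : r * cos ph = al.
  rewrite /ph cos_atan /r cabsE yE /= /x.
  have -> : al ^+ 2 + be ^+ 2 = al ^+ 2 * (1 + (be / al) ^+ 2) by field; rewrite gt_eqF.
  rewrite sqrtrM ?sqr_ge0// sqrtr_sqr gtr0_norm// mulfK//.
  by rewrite gt_eqF// sqrtr_gt0 ltr_pwDl// sqr_ge0.
have cn0 : cos ph != 0.
  by apply/eqP => c0; move: rE; rewrite c0 mulr0 => h; rewrite -h ltxx in alp.
have sE : r * sin ph = be.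
  have : tan ph = x by rewrite /ph atanK.
  rewrite /tan => /(canRL (mulfVK cn0)) ->.
  by rewrite mulrCA rE /x divfK// gt_eqF.
exists (ln r)%:C%C, (0 +i* ph)%C, (r%:C%C), (cos ph +i* sin ph)%C; split.
- by have := @exp_series_real (ln r); rewrite lnr.
- exact: exp_series_imag.
- rewrite yE; apply/eqP; rewrite eq_complex /= !mul0r subr0 addr0.
  by rewrite rE sE !eqxx.
have l1 : cabs (ln r)%:C%C <= 2 * cabs y.
  apply: le_trans (cabs_le _) _; rewrite /= normr0 addr0.
  by apply: le_trans lnb _; rewrite ler_pM2l.
have l2 : cabs (0 +i* ph)%C <= 2 * cabs y.
  apply: le_trans (cabs_le _) _; rewrite /= normr0 add0r.
  have hx : `|ph| <= `|x|.
    rewrite /ph; have [x0|x0] := leP 0 x; first by rewrite [leRHS]ger0_norm// atan_le.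
    rewrite [leRHS]ltr0_norm//; have := @atan_le (- x).
    by rewrite atanN normrN oppr_ge0; apply; exact: ltW.
  apply: le_trans hx _; rewrite normrM normfV (gtr0_norm alp) ler_pdivrMr//.
  have : `|be| <= cabs y by exact: cabs_Im.
  have := normr_ge0 be; nra.
lra.
Qed.

Definition complex_field : hermitian_field R C.
Proof.
apply: (@HermitianField R C (real_complex R) (@conjc R) (@complex.Re R) (@cabs R)).
- exact: conjcK.
- exact: conjc_real.
- by move=> [p q] [p' q'].
- by move=> a [p q] /=; rewrite mul0r subr0.
- by case.
- by [].
- by move=> z; rewrite mulrC -sqr_normc -cabs_norm rmorphXn.
- exact: cabs_norm.
- by move=> a b; rewrite lecR.
- exact: complex_series_cvg.
- by exists 4 => // y; exact: complex_log.
Defined.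

End ComplexInstance.

Theorem theorem5p5 (R : realType) :
  (forall (k : nat) (s : 'I_k -> R) (B : 'I_k -> 'M[R]_2),
      (0 < k)%N ->
      (forall i, 0 < s i) ->
      (forall i, opnormR (B i) = 1) ->
      magnusR (prod_exp s B) = \sum_(i < k) s i ->
      (exists (U : 'M[R]_2) (eps : R) (lam : 'I_k -> R),
          [/\ orthogonal_mx U, (eps = 1 \/ eps = -1) &
              forall i, U *m B i *m invmx U = diag2 eps (lam i)])
      \/
      (exists U0 : 'M[R]_2, orthogonal_mx U0 /\ forall i, B i = U0))
  /\
  (forall (k : nat) (s : 'I_k -> R) (B : 'I_k -> 'M[R[i]]_2),
      (0 < k)%N ->
      (forall i, 0 < s i) ->
      (forall i, opnormC (B i) = 1) ->
      magnusC (prod_exp (fun i => (s i)%:C%C) B) = \sum_(i < k) s i ->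
      exists (V : 'M[R[i]]_2) (u : R[i]) (lam : 'I_k -> R[i]),
        [/\ unitary_mx V, `|u| = 1 &
            forall i, V *m B i *m invmx V = diag2 u (lam i)]).
Proof.
split=> k s B k0 s0 B1 hM.
  have adjE (V : 'M[R]_2) : adj (real_field R) V = V^T.
    by apply/matrixP => i j; rewrite !mxE.
  have B1' i : op (real_field R) (B i) <= 1 by rewrite [op _ _](B1 i).
  have [[U uU hU]|[x [c [x1 c1 hx]]]] := @magnus_extremal R R (real_field R) k s B k0 s0 B1 hM.
    by right; exists U; split => //; rewrite /orthogonal_mx -adjE.
  left; have [V [uV hV]] := diagonalize x1.
  have /choice[lam hlam] i : exists d, V *m B i *m invmx V = diag2 c d.
    exact: (hV _ _ (B1' i) c1 (hx i)).
  exists V, c, lam; split => //; first by rewrite /orthogonal_mx -adjE.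
  have {}c1 : `|c| = 1 := c1.
  have [c0|c0] := leP 0 c; [left|right]; first by rewrite -c1 ger0_norm.
  by rewrite -c1 ltr0_norm ?opprK.
have adjE (V : 'M[R[i]]_2) : adj (complex_field R) V = (map_mx Num.conj V)^T.
  by apply/matrixP => i j; rewrite !mxE.
have B1' i : op (complex_field R) (B i) <= 1 by rewrite [op _ _](B1 i).
(* Over [R[i]] the unitary alternative also yields a common eigenvector, so a single conclusion
   remains. *)
suff [x [c [x1 c1 hx]]] : exists x c, [/\ nsq (complex_field R) x = 1,
    av (complex_field R) c = 1 & forall i, B i *m x = c *: x].
  have [V [uV hV]] := diagonalize x1.
  have /choice[lam hlam] i : exists d, V *m B i *m invmx V = diag2 c d.
    exact: (hV _ _ (B1' i) c1 (hx i)).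
  exists V, c, lam; split => //; first by rewrite /unitary_mx -adjE.
  by rewrite -cabs_norm [cabs c]c1.
have [[U uU hU]|//] := @magnus_extremal R _ (complex_field R) k s B k0 s0 B1 hM.
(* Eigenvectors are rows here, so the transpose is used to obtain a column eigenvector of [U]; its
   eigenvalue is unimodular because [U] preserves lengths. *)
have [c] := eigenvalue_closed U^T isT.
move=> /eigenvalueP[v vU v0]; pose w := v^T.
have wU : U *m w = c *: w by rewrite /w -[U in LHS]trmxK -trmx_mul vU linearZ.
pose H := complex_field R.
have w0 : nsq H w != 0.
  by apply/eqP => /nsq_eq0 w0; move: v0; rewrite -[v]trmxK -/w w0 trmx0 eqxx.
have wp : 0 < nsq H w by rewrite lt_def w0 nsq_ge0.
have c1 : av H c = 1.
  have : av H c ^+ 2 * nsq H w = nsq H w by rewrite -nsqZ -wU unitary_nsq.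
  move=> /(canRL (mulfK w0)); rewrite mulfV// => /eqP.
  rewrite sqrf_eq1 => /orP[/eqP//|/eqP h].
  by have := av_ge0 H c; rewrite h; lra.
exists (emb H (nrm H w)^-1 *: w), c; split => //.
  by rewrite nsqZ av_emb real_normK ?num_real// exprVn nrm_sqr mulVf.
by move=> i; rewrite hU -scalemxAr wU !scalerA mulrC.
Qed.
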